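(* Let $N\ge1$ and let $g$ be a centrally symmetric interaction kernel on $\mathbb{R}^N$ (with $g(x)=g(-x)$) such that: (i) $g$ is bounded from below, lower semicontinuous and belongs to $L^1_{\rm loc}(\mathbb{R}^N)$; (ii) $\liminf_{|x|\to\infty}g(x)\ge0$; (iii) $g$ is continuous in $\mathbb{R}^N\setminus\{0\}$, and radial and decreasing in a neighborhood of the origin, i.e. there exists $\bar r>0$ such that $g(x)\ge g(y)$ whenever $0<|x|\le|y|<\bar r$; (iv) there exists $\mu_0\in\mathcal{P}(\mathbb{R}^N)$ with $\mathcal{E}(\mu_0)<0$. Then there exists $\bar n\in\mathbb{N}$ such that, for every $n>\bar n$, the functional $\mathcal{E}_n$ admits a minimizer.
   Context: $\mathcal{P}(\mathbb{R}^N)$ is the set of Borel probability measures on $\mathbb{R}^N$. The kernel $g$ takes real values on $\mathbb{R}^N\setminus\{0\}$ and $g(0)\in(-\infty,+\infty]$. The continuum energy is $\mathcal{E}(\mu)=\int_{\mathbb{R}^N}\int_{\mathbb{R}^N}g(x-y)\,d\mu(x)\,d\mu(y)\in(-\infty,+\infty]$ for $\mu\in\mathcal{P}(\mathbb{R}^N)$. An $n$-discrete probability measure is a measure of the form $\frac1n\sum_{i=1}^n\delta_{x_i}$ with $x_1,\dots,x_n\in\mathbb{R}^N$ (not necessarily distinct). For $n\ge1$ the discrete energy $\mathcal{E}_n:\mathcal{P}(\mathbb{R}^N)\to(-\infty,+\infty]$ is $$\mathcal{E}_n(\mu)=\frac1{n^2}\sum_{1\le i\ne j\le n}g(x_i-x_j)\quad\text{if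 }\mu=\frac1n\sum_{i=1}^n\delta_{x_i},$$ and $\mathcal{E}_n(\mu)=+\infty$ if $\mu$ is not $n$-discrete. A minimizer of $\mathcal{E}_n$ is an $n$-discrete probability measure at which the infimum of $\mathcal{E}_n$ is attained. *)

(* Defs.v *)
From HB Require Import structures.
From mathcomp Require Import all_boot all_order all_algebra perm.
From mathcomp Require Import all_classical all_reals all_analysis.
From mathcomp Require Import measurable_realfun.

Set Implicit Arguments.
Unset Strict Implicit.
Unset Printing Implicit Defensive.

Import Order.TTheory GRing.Theory Num.Theory.
Import numFieldNormedType.Exports.

Local Open Scope classical_set_scope.
Local Open Scope ring_scope.

(* R^N is 'rV[R]_N. The library topology on matrices comes from the sup norm,
   so it is the Euclidean one; matrices get the Borel sigma-algebra of that
   topology. *)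
HB.instance Definition _ (R : realType) (m n : nat) :=
  @isMeasurable.Build (sigma_display (@open 'M[R]_(m, n))) 'M[R]_(m, n)
    <<s @open 'M[R]_(m, n) >> (@sigma_algebra0 _ setT _)
    (@sigma_algebraC 'M[R]_(m, n) _) (@sigma_algebra_bigcup _ setT _).

Section borel_mx.
Context {R : realType} {m n : nat}.

Lemma open_measurable_mx (U : set 'M[R]_(m, n)) : open U -> measurable U.
Proof. exact: sub_sigma_algebra. Qed.

Lemma measurable_coord (i : 'I_m) (j : 'I_n) :
  measurable_fun setT (fun x : 'M[R]_(m, n) => x i j : measurableTypeR R).
Proof.
apply: (measurability _ (RGenOpens.measurableE R)) => _ [_ [a [b ->] <-]].
rewrite setTI; apply: open_measurable_mx; apply: open_comp => [x _|].
  exact: coord_continuous.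
exact: interval_open.
Qed.

Lemma measurable_fun_mx d (T : measurableType d) (f : T -> 'M[R]_(m, n)) :
  (forall i j, measurable_fun setT (fun x => f x i j : measurableTypeR R)) ->
  measurable_fun setT f.
Proof.
move=> mf; apply: (@measurability _ _ _ _ _ _ (@open 'M[R]_(m, n))) => // _ [U oU <-].
rewrite setTI.
pose B (p : 'M[rat]_(m, n) * nat) : set 'M[R]_(m, n) :=
  ball (map_mx ratr p.1 : 'M[R]_(m, n)) p.2.+1%:R^-1.
have -> : f @^-1` U =
    \bigcup_p (if `[< B p `<=` U >] then f @^-1` B p else set0).
  apply/seteqP; split=> [x /= Ux|x [p _]]; last first.
    by case: ifPn => // /asboolP + ?; exact.
  have [e /= e0 eU] : exists2 e : R, 0 < e & ball (f x) e `<=` U.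
    by have /nbhs_ballP[e] := oU _ Ux; exists e.
  have [k _ ke] : exists2 k, True & k.+1%:R^-1 < e / 2 :> R.
    have e20 : 0 < e / 2 by rewrite divr_gt0.
    have [k _ /(_ _ (leqnn _))] := near_infty_natSinv_lt (PosNum e20).
    by exists k.
  have k0 : 0 < k.+1%:R^-1 :> R by rewrite invr_gt0.
  have /choice[q qP] : forall ij : 'I_m * 'I_n, exists q : rat,
      ball (f x ij.1 ij.2) k.+1%:R^-1 (ratr q : R).
    move=> ij; have oB : open (ball (f x ij.1 ij.2 : R) k.+1%:R^-1).
      exact: ball_open.
    have B0 : ball (f x ij.1 ij.2 : R) k.+1%:R^-1 !=set0.
      by exists (f x ij.1 ij.2); exact: ballxx.
    by have [y [By [q _ qy]]] := dense_rat B0 oB; exists q; rewrite qy.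
  exists (\matrix_(i, j) q (i, j), k) => //.
  have Bfx : B (\matrix_(i, j) q (i, j), k) (f x).
    by split => //= i j; rewrite !mxE; exact/ball_sym/(qP (i, j)).
  rewrite asboolT//= => y By; apply: eU; rewrite (splitr e).
  exact: ball_triangle (le_ball (ltW ke) (ball_sym Bfx)) (le_ball (ltW ke) By).
apply: countable_bigcupT_measurable => [|p]; first exact: countableP.
 case: ifPn => // _.
have -> : f @^-1` B p = \bigcap_ij [set x | 
   ball (ratr (p.1 ij.1 ij.2) : R) p.2.+1%:R^-1 (f x ij.1 ij.2)].
  apply/seteqP; split=> [x [_ Bx] [i j] _ /=|x Bx].
    by have := Bx i j; rewrite mxE.
  by split => [|i j]; [rewrite invr_gt0|rewrite mxE; exact: (Bx (i, j))].
apply: fin_bigcap_measurable => [|[i j] _ /=]; first exact: finite_finset.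
rewrite -[X in measurable X]setTI; apply: mf => //.
by apply: open_measurable; exact: ball_open.
Qed.

End borel_mx.

(* The sigma-finiteness instance of the library for \x is shadowed by the one
   for subprobabilities. *)
Lemma sigma_finite_product d1 d2 (T1 : measurableType d1)
    (T2 : measurableType d2) (R : realType)
    (m1 : {sigma_finite_measure set T1 -> \bar R})
    (m2 : {sigma_finite_measure set T2 -> \bar R}) :
  sigma_finite setT (m1 \x m2)%E.
Proof.
have /sigma_finiteP[F [TF ndF Foo]] := sigma_finiteT m1.
have /sigma_finiteP[G [TG ndG Goo]] := sigma_finiteT m2.
exists (fun n => F n `*` G n).
  rewrite -setXTT TF TG predeqE => -[x y]; split.
    move=> [/= [n _ Fnx] [k _ Gky]]; exists (maxn n k) => //; split.
    - by move: x Fnx; exact/subsetPset/ndF/leq_maxl.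
    - by move: y Gky; exact/subsetPset/ndG/leq_maxr.
  by move=> [n _ []/= ? ?]; split; exists n.
move=> k; have [? ?] := Foo k; have [? ?] := Goo k.
split; first exact: measurableX.
by rewrite product_measure1E// lte_mul_pinfty// ge0_fin_numE.
Qed.

Section lebesgue_rV.
Context {R : realType}.

Section step.
Context {n : nat}.

Definition cons_rV (p : measurableTypeR R * 'rV[R]_n) : 'rV[R]_n.+1 :=
  row_mx (p.1%:M : 'M[R]_1) p.2.

Let cons_rV0 p : cons_rV p ord0 ord0 = p.1.
Proof.
have -> : ord0 = @lshift 1 n ord0 by exact/val_inj.
by apply: etrans (row_mxEl _ _ _ _) _; rewrite mxE eqxx.
Qed.

Let cons_rVS p k : cons_rV p ord0 (rshift 1 k) = p.2 ord0 k.
Proof. exact: row_mxEr. Qed.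

Let uncons (v : 'rV[R]_n.+1) : measurableTypeR R * 'rV[R]_n :=
  (v ord0 ord0, @rsubmx _ 1 1 n v).

Let consK : cancel cons_rV uncons.
Proof.
by move=> [a v]; rewrite /uncons cons_rV0 /cons_rV row_mxKr.
Qed.

Lemma measurable_cons_rV : measurable_fun setT cons_rV.
Proof.
apply: measurable_fun_mx => i j; rewrite ord1.
have [->|[k ->]] : j = ord0 \/ exists k, j = rshift 1 k :> 'I_(1 + n).
- by case: (@split_ordP 1 n j) => k ->; [left; rewrite ord1; exact/val_inj|
                                        right; exists k].
- rewrite (_ : (fun _ => _) = fst) //; apply/funext => p.
  exact: cons_rV0.
- rewrite (_ : (fun _ => _) = (fun v : 'rV[R]_n => v ord0 k) \o snd).
    exact: measurableT_comp (measurable_coord ord0 k) measurable_snd.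
  by apply/funext => p; exact: cons_rVS.
Qed.

Let measurable_uncons : measurable_fun setT uncons.
Proof.
apply/measurable_fun_pairP; split.
  exact: measurable_coord.
apply: measurable_fun_mx => i j.
rewrite (_ : (fun _ => _) = fun v : 'rV[R]_n.+1 => v i (rshift 1 j)).
  exact: measurable_coord.
by apply/funext => v; rewrite /= mxE.
Qed.

HB.instance Definition _ := isMeasurableFun.Build _ _ _ _ _ measurable_cons_rV.

Variable mu : {sigma_finite_measure set 'rV[R]_n -> \bar R}.

Definition lebesgue_step : set 'rV[R]_n.+1 -> \bar R :=
  pushforward (@lebesgue_measure R \x mu)%E cons_rV.

Let step0 : lebesgue_step set0 = 0%E. Proof. exact: measure0. Qed.
Let step_ge0 A : (0 <= lebesgue_step A)%E. Proof. exact: measure_ge0. Qed.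
Let step_sigma_additive : semi_sigma_additive lebesgue_step.
Proof. exact: measure_semi_sigma_additive. Qed.

HB.instance Definition _ := isMeasure.Build _ _ _ lebesgue_step
  step0 step_ge0 step_sigma_additive.

Let step_sigma_finite : sigma_finite setT lebesgue_step.
Proof.
have [F FT Foo] := sigma_finite_product (@lebesgue_measure R) mu.
exists (fun k => uncons @^-1` F k).
  by rewrite -preimage_bigcup -FT preimage_setT.
move=> k; have [mF Fk] := Foo k; split.
  by rewrite -[X in measurable X]setTI; exact: measurable_uncons.
rewrite /lebesgue_step /pushforward -comp_preimage.
by rewrite (_ : uncons \o cons_rV = id)//; apply/funext => p /=; rewrite consK.
Qed.

HB.instance Definition _ := Measure_isSigmaFinite.Build _ _ _ lebesgue_step
  step_sigma_finite.

End step.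

(* Lebesgue measure on R^N: the N-fold product of the one-dimensional one, the
   point 'rV[R]_0 having mass 1. *)
Fixpoint lebesgue_rV (N : nat) :
    {sigma_finite_measure set 'rV[R]_N -> \bar R} :=
  if N is n.+1 then lebesgue_step (lebesgue_rV n) else dirac (0 : 'rV[R]_0).

End lebesgue_rV.

Section euclidean.
Context {R : realType} {N : nat}.

(* The norm `|x| of the library is the sup norm. *)
Definition enorm (x : 'rV[R]_N) : R := Num.sqrt (\sum_i x ord0 i ^+ 2).

Definition at_infinity : set_system 'rV[R]_N :=
  [set A | exists M : R, forall x, M < enorm x -> A x].

End euclidean.

Section kernel.
Context {R : realType} {N : nat}.
Local Open Scope ereal_scope.
Implicit Types (g : 'rV[R]_N -> \bar R) (mu : probability 'rV[R]_N R).

Definition locally_integrable_rV g :=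
  forall K : set 'rV[R]_N, compact K -> (lebesgue_rV N).-integrable K g.

Definition energy g mu : \bar R := \int[mu]_y \int[mu]_x g (x - y)%R.

Definition empirical n (x : 'I_n -> 'rV[R]_N) (A : set 'rV[R]_N) : \bar R :=
  (n%:R^-1)%:E * \sum_(i < n) \d_(x i) A.

(* The values of mu outside the Borel sets are irrelevant. *)
Definition represents n (x : 'I_n -> 'rV[R]_N) mu :=
  forall A, measurable A -> mu A = empirical x A.

Definition n_discrete n mu := exists x : 'I_n -> 'rV[R]_N, represents x mu.

Definition config_energy g n (x : 'I_n -> 'rV[R]_N) : \bar R :=
  (n%:R ^- 2)%:E * \sum_(i < n) \sum_(j < n | i != j) g (x i - x j)%R.

(* The points representing mu are determined only up to order, so one choice
   is made; discrete_energyE says that it does not matter. *)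
Definition discrete_energy g n mu : \bar R :=
  if pselect (n_discrete n mu) is left h then config_energy g (projT1 (cid h))
  else +oo.

Definition is_minimizer g n mu :=
  n_discrete n mu /\
  discrete_energy g n mu = ereal_inf (range (discrete_energy g n)).

Lemma measurable_rV1 (a : 'rV[R]_N) : measurable [set a].
Proof.
rewrite -[X in measurable X]setCK; apply: measurableC.
apply: open_measurable_mx; apply: closed_openC.
exact/accessible_closed_set1/hausdorff_accessible/norm_hausdorff.
Qed.

Lemma represents_perm n (x y : 'I_n -> 'rV[R]_N) mu :
  represents x mu -> represents y mu ->
  exists s : {perm 'I_n}, forall i, x i = y (s i).
Proof.
move=> xmu ymu.
have [n0|n0] := posnP n.
  by exists 1%g => i; have := ltn_ord i; rewrite [X in (_ < X)%N]n0.
have cE (z : 'I_n -> 'rV[R]_N) a : represents z mu ->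
    mu [set a] = (n%:R^-1 * (count_mem a [tuple z i | i < n])%:R)%:E.
  move=> /(_ _ (measurable_rV1 a)) ->; rewrite /empirical EFinM; congr (_ * _).
  rewrite -sum1_count big_tuple natr_sum -sumEFin [RHS]big_mkcond /=.
  apply: eq_bigr => i _; rewrite diracE classical_sets.in_set1.
  by rewrite tnth_mktuple eq_sym; case: eqP.
have : perm_eq [tuple x i | i < n] [tuple y i | i < n].
  apply/allP => a _ /=; apply/eqP.
  have := cE x a xmu; rewrite (cE y a ymu) => -[]/mulfI h.
  apply/eqP; rewrite -(eqr_nat R) eq_sym; apply/eqP/h.
  by rewrite invr_eq0 pnatr_eq0 -lt0n.
move=> /tuple_permP[s xs]; exists s => i.
have /val_inj/(congr1 (fun t : n.-tuple _ => tnth t i)) := xs.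
by rewrite !tnth_mktuple.
Qed.

Lemma discrete_energyE g n (x : 'I_n -> 'rV[R]_N) mu :
  represents x mu -> discrete_energy g n mu = config_energy g x.
Proof.
move=> xmu; rewrite /discrete_energy.
case: pselect => [h|[]]; last by exists x.
case: cid => y /= ymu; have [s yx] := represents_perm ymu xmu.
congr (_ * _); rewrite [RHS](reindex_inj (@perm_inj _ s)) /=.
apply: eq_bigr => i _; rewrite [RHS](reindex_inj (@perm_inj _ s)) /=.
by apply: eq_big => [j|j _]; rewrite ?(inj_eq perm_inj)// !yx.
Qed.

End kernel.

(* Main.v *)
Require Import Defs.
From HB Require Import structures.
From mathcomp Require Import all_boot all_order all_algebra.
From mathcomp Require Import all_classical all_reals all_analysis.
From mathcomp Require Import measurable_realfun ring lra.

(* Write P(s) for the sum of g over the unordered pairs of points of s. Removing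
   one point and averaging shows that min P / (n (n - 1)) is nondecreasing in n,
   and independent samples of mu_0 keep it below a negative constant, so that
   min P = - B n^2 + o(n^2) with B > 0. Hence a nearly optimal configuration of
   n points cannot split into two distant groups of comparable size
   ((a + b)^2 > a^2 + b^2): all points but a proportion eps lie in a ball whose
   radius depends only on g, and discarding the k outer points costs little,
   at most (B / 8) k n. They are put back inside the ball with a gain of B per
   point and per remaining point, so that some configuration in a fixed ball is
   at least as good, and compactness with lower semicontinuity conclude.
   To find a good place for a new point when g(0) = +oo, take the points Y1
   which are extreme in the first coordinate, a small proportion of all; on
   average they have a very negative potential with respect to the other ones,
   since removing Y1 removes an energy of order - n |Y1|. Shifting a point of Y1
   by a small vector u pointing outward increases its distance to the other
   points, hence decreases g near the origin, and changes g little elsewhere by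
   uniform continuity. The interaction of the shifted points with Y1 and with
   the new points is bounded by averaging over u, as g is locally integrable. *)

Set Implicit Arguments.
Unset Strict Implicit.
Unset Printing Implicit Defensive.

Import Order.TTheory GRing.Theory Num.Theory.
Import numFieldNormedType.Exports.

Local Open Scope classical_set_scope.
Local Open Scope ring_scope.

(** * Pair sums *)

Lemma sumr_const_seq (W : nmodType) (T : Type) (s : seq T) (c : W) :
  \sum_(x <- s) c = c *+ size s.
Proof. by rewrite big_const_seq count_predT iter_addr_0. Qed.

Section pairsum.
Context {V : zmodType} {W : nmodType}.
Implicit Types (k f : V -> W) (s t : seq V).

(* Unnormalized, and each unordered pair is counted once: n ^ 2 / 2 times the
   discrete energy of the paper. *)
Fixpoint pairsum k s : W :=
  if s is x :: s' then \sum_(y <- s') k (x - y) + pairsum k s' else 0.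

Definition crosssum k s t : W := \sum_(x <- s) \sum_(y <- t) k (x - y).

Lemma crosssum_catr k s t u :
  crosssum k s (t ++ u) = crosssum k s t + crosssum k s u.
Proof. by rewrite -big_split; apply: eq_bigr => x _; rewrite big_cat. Qed.

Lemma crosssum_catl k s t u :
  crosssum k (s ++ t) u = crosssum k s u + crosssum k t u.
Proof. by rewrite /crosssum big_cat. Qed.

Lemma crosssumC k s t : (forall x, k (- x) = k x) ->
  crosssum k s t = crosssum k t s.
Proof.
move=> kN; rewrite /crosssum exchange_big; apply: eq_bigr => x _.
by apply: eq_bigr => y _; rewrite -kN opprB.
Qed.

Lemma pairsum_cat k s t :
  pairsum k (s ++ t) = pairsum k s + crosssum k s t + pairsum k t.
Proof.
elim: s => [|x s IHs] /=; first by rewrite /crosssum big_nil !add0r.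
by rewrite IHs big_cat /crosssum big_cons /= -!addrA; congr (_ + _); rewrite addrCA.
Qed.

Lemma pairsum_perm k s t : (forall x, k (- x) = k x) ->
  perm_eq s t -> pairsum k s = pairsum k t.
Proof.
move=> kN; move: s t; apply: catCA_perm_subst => s t u.
rewrite !pairsum_cat !crosssum_catr (crosssumC s t kN).
by rewrite [LHS](AC (1*2*3) (4*(2*5)*(1*3*6))).
Qed.

Lemma pairsum_map_subr k s p : pairsum k [seq x - p | x <- s] = pairsum k s.
Proof.
elim: s => //= x s ->; congr (_ + _); rewrite big_map.
by apply: eq_bigr => y _; rewrite opprB addrA subrK.
Qed.

Lemma crosssum_diag k s : (forall x, k (- x) = k x) ->
  crosssum k s s = pairsum k s *+ 2 + k 0 *+ size s.
Proof.
move=> kN; elim: s => [|x s IHs]; first by rewrite /crosssum big_nil mul0rn addr0.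
rewrite -cat1s crosssum_catl !crosssum_catr IHs (crosssumC s [:: x] kN).
have -> : crosssum k [:: x] [:: x] = k 0 by rewrite /crosssum !big_seq1 subrr.
have -> : crosssum k [:: x] s = \sum_(y <- s) k (x - y) by rewrite /crosssum big_seq1.
rewrite /= mulrnDl [k 0 *+ _.+1]mulrS !mulr2n.
by rewrite [LHS](AC (2*(1*(2*1))) ((2*3)*(4*5)*(1*6))).
Qed.

Lemma pairsumD k f s :
  pairsum (fun x => k x + f x) s = pairsum k s + pairsum f s.
Proof.
elim: s => [|x s IHs] /=; first by rewrite addr0.
by rewrite IHs big_split /= addrACA.
Qed.

End pairsum.

Section pairsum_real.
Context {R : realType} {V : zmodType}.
Implicit Types (k f : V -> R) (s t : seq V).

Lemma ler_pairsum k f s : (forall x, k x <= f x) -> pairsum k s <= pairsum f s.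
Proof. by move=> kf; elim: s => //= x s IHs; rewrite lerD ?ler_sum. Qed.

Lemma ler_crosssum k s t (c : R) :
  (forall x y, x \in s -> y \in t -> c <= k (x - y)) ->
  (size s)%:R * (size t)%:R * c <= crosssum k s t.
Proof.
move=> kc; rewrite -mulrA mulr_natl -sumr_const_seq /crosssum.
rewrite big_seq_cond [leRHS]big_seq_cond ler_sum// => x /andP[xs _].
rewrite mulr_natl -sumr_const_seq big_seq_cond [leRHS]big_seq_cond.
by rewrite ler_sum// => y /andP[yt _]; exact: kc.
Qed.

Lemma ler_pairsum_cst k s (c : R) : c <= 0 -> (forall x, c <= k x) ->
  (size s)%:R ^+ 2 / 2 * c <= pairsum k s.
Proof.
move=> c0 kc; elim: s => [|x s IHs] /=; first by rewrite expr0n !mul0r.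
have : (size s)%:R * c <= \sum_(y <- s) k (x - y).
  by rewrite mulr_natl -sumr_const_seq ler_sum.
move/lerD/(_ IHs); apply: le_trans; rewrite -natr1.
by have := ler0n R (size s); nra.
Qed.

Lemma pairsumZ (c : R) f s : pairsum (fun x => c * f x) s = c * pairsum f s.
Proof.
elim: s => [|x s IHs] /=; first by rewrite mulr0.
by rewrite IHs mulrDr mulr_sumr.
Qed.

Lemma pairsum_cst (c : R) s :
  pairsum (fun=> c) s = c * (size s)%:R * ((size s)%:R - 1) / 2.
Proof.
elim: s => [|x s IHs] /=; first by rewrite mulr0 !mul0r.
rewrite IHs sumr_const_seq -[c *+ _]mulr_natl -natr1; by field.
Qed.

End pairsum_real.

(** * Nearly optimal configurations are concentrated *)

Lemma exists_nat_ge (R : realType) (x : R) : exists n : nat, x <= n%:R.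
Proof.
exists (Num.bound `|x|); apply: le_trans (ler_norm x) _.
exact/ltW/archi_boundP/normr_ge0.
Qed.

(** Pigeonhole: the [A] increments telescope to at most [n], so one of them does not exceed the
    average. *)
Lemma small_increment (R : realType) (A : nat) (m : nat -> nat) (n : nat) :
  (0 < A)%N -> (m A <= n)%N ->
  exists2 a, (a < A)%N & (m a.+1)%:R - (m a)%:R <= n%:R / A%:R :> R.
Proof.
move=> A0 mAn; apply: contrapT => /forall2NP H.
have : \sum_(0 <= a < A) (n%:R / A%:R) < \sum_(0 <= a < A) ((m a.+1)%:R - (m a)%:R) :> R.
  apply: ltr_sum_nat => // a /andP[_ aA].
  by have [//|/negP] := H a; rewrite -ltNge.
rewrite sumr_const_nat subn0 -[ltLHS]mulr_natr divfK ?pnatr_eq0 -?lt0n//.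
rewrite telescope_sumr// => nm.
have : (m A)%:R <= n%:R :> R by rewrite ler_nat.
have := ler0n R (m 0%N); lra.
Qed.

Lemma split_cost_bound (R : realFieldType) (x1 x2 x3 n eps tau eta C B c : R) :
  0 <= x1 -> 0 <= x2 -> 0 <= x3 -> 0 <= c -> 0 <= eps -> 0 <= B ->
  n = x1 + x3 + x2 -> c * x3 <= tau * n -> 2 * C <= tau * n ^+ 2 ->
  2 * eps <= tau -> eta <= B ->
  - (B + eps) * x1 ^+ 2 - C + - c * x1 * x3 + x3 ^+ 2 / 2 * - c +
    (- eta * x1 * x2 + - c * x3 * x2) + (- (B + eps) * x2 ^+ 2 - C)
  <= - (B - eps) * n ^+ 2 -> B * (x1 * x2) <= 3 * tau * n ^+ 2.
Proof.
move=> x10 x20 x30 c0 e0 B0 nE cx3 hC et etaB H.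
have n0 : 0 <= n by rewrite nE !addr_ge0.
have h1 : c * x3 * (x1 + x2 + x3 / 2) <= tau * n ^+ 2.
  rewrite expr2 mulrA ler_pM ?mulr_ge0 ?addr_ge0 ?divr_ge0// nE; lra.
have h2 : (B + eps) * ((x1 + x2) ^+ 2) <= (B + eps) * n ^+ 2.
  by rewrite ler_wpM2l ?addr_ge0// ler_sqr ?nnegrE ?addr_ge0// nE; lra.
have h3 : eta * (x1 * x2) <= B * (x1 * x2) by rewrite ler_wpM2r ?mulr_ge0.
have h4 : 2 * eps * n ^+ 2 <= tau * n ^+ 2 by rewrite ler_wpM2r ?sqr_ge0.
have h5 : 0 <= eps * (x1 * x2) by rewrite !mulr_ge0.
nra.
Qed.

Lemma outer_cost_bound (R : realFieldType) (x1 x2 x3 n B c X12 X32 P2 : R) :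
  0 <= B -> 0 <= x2 -> 0 <= n -> x1 <= n -> c * x3 <= B / 24 * n -> c * x2 <= B / 24 * n ->
  - (B / 24) * x1 * x2 <= X12 -> - c * x3 * x2 <= X32 -> x2 ^+ 2 / 2 * - c <= P2 ->
  0 <= X12 + X32 + P2 + B / 8 * x2 * n.
Proof.
move=> B0 x20 n0 x1n c3 c2 h12 h32 h2.
have e1 := ler_wpM2l x20 c3; have e2 := ler_wpM2l x20 c2.
have e3 := ler_wpM2l B0 (ler_wpM2r x20 x1n).
have e4 : 0 <= B * (x2 * n) by rewrite !mulr_ge0.
rewrite expr2 in h2; lra.
Qed.

(** Removing [j] points from a nearly optimal configuration must raise the energy by about 2 B j n -
    B j ^ 2 >= B j n. An increase of at most (B / 8) j n therefore forces [j] to be of order eps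
    n. *)
Lemma outer_size_bound (R : realFieldType) (j n B eps C pI ps : R) :
  0 < B -> 0 < eps -> 0 <= j -> j <= n -> 0 < n -> C <= eps * n ^+ 2 ->
  - (B + eps) * (n - j) ^+ 2 - C <= pI -> pI <= ps + B / 8 * j * n ->
  ps <= - (B - eps) * n ^+ 2 -> j * B <= 6 * eps * n.
Proof.
move=> B0 e0 j0 jn n0 hC hI hs Ps.
have sq : (n - j) ^+ 2 <= n ^+ 2 - n * j by nra.
have h1 := ler_wpM2l (addr_ge0 (ltW B0) (ltW e0)) sq.
have h2 : 0 <= eps * (n * j) by rewrite !mulr_ge0// ltW.
have h3 : 0 <= B * (n * j) by rewrite !mulr_ge0// ltW.
rewrite -(ler_pM2r n0) -[6 * eps * n * n]mulrA -expr2; lra.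
Qed.

Section core.
Context {R : realType} {V : normedModType R}.
Variables (f : V -> R) (adm : rel V) (c B : R).
Hypotheses (c_gt0 : 0 < c) (B_gt0 : 0 < B).
Hypothesis fN : forall x, f (- x) = f x.
Hypothesis f_ge : forall x, - c <= f x.
Hypothesis f_far : forall eta : R, 0 < eta ->
  exists2 r : R, 0 < r & forall x, r < `|x| -> - eta <= f x.
Hypothesis pairsum_lb : forall eps : R, 0 < eps -> exists C : R,
  forall s, pairwise adm s -> - (B + eps) * (size s)%:R ^+ 2 - C <= pairsum f s.

(** By contradiction: [f] is at least [- eta], lowered by [c] on the pairs at distance at most [r].
    If every point had few neighbours, double counting the close pairs would keep the energy above -
    (B + eta) n ^ 2 / 2, which [eps_eta] excludes. *)
Lemma crowded_ball (eps eta r : R) (s : seq V) :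
  0 < eta -> eps + eta <= B / 2 ->
  (forall x, r < `|x| -> - eta <= f x) -> (0 < size s)%N ->
  pairsum f s <= - (B - eps) * (size s)%:R ^+ 2 ->
  exists2 x, x \in s & B / c * (size s)%:R <= (count (fun y => `|x - y| <= r) s)%:R.
Proof.
move=> eta0 eps_eta far s0 Ps; apply: contrapT => /forall2NP H.
pose close (x : V) : R := (`|x| <= r)%R%:R.
have closeN x : close (- x) = close x by rewrite /close normrN.
have close0 x : 0 <= close x by exact: ler0n.
have /(ler_pairsum s) : forall x, - eta + - c * close x <= f x.
  move=> x; rewrite /close; case: (leP `|x| r) => [_|xr] /=; last by have := far _ xr; lra.
  by have := f_ge x; lra.
rewrite pairsumD pairsumZ pairsum_cst.
have : crosssum close s s < B / c * (size s)%:R ^+ 2.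
  rewrite expr2 mulrA [ltRHS]mulr_natr -sumr_const_seq /crosssum.
  rewrite big_seq_cond [ltRHS]big_seq_cond ltr_sum// => [|x /andP[xs _]].
    by case: s s0 {Ps H} => // x s _; apply/hasP; exists x; rewrite ?mem_head.
  have [//|/negP] := H x; rewrite -ltNge; apply: le_lt_trans.
  by rewrite -sum1_count natr_sum [leRHS]big_mkcond ler_sum// => y _;
    rewrite /close; case: ifP.
rewrite crosssum_diag// -[_ *+ size s]mulr_natr -[_ *+ 2]mulr_natr.
have := close0 0; set z := close 0 => z0; set Q := pairsum close s.
have : 1 <= (size s)%:R :> R by rewrite ler1n.
move: Ps; set P := pairsum f s; set n : R := (size s)%:R => Ps n1 h1 h2.
have h3 : Q * 2 < B / c * n ^+ 2 by nra.
have h4 : c * Q * 2 < B * n ^+ 2.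
  have -> : B * n ^+ 2 = c * (B / c * n ^+ 2) by field; rewrite gt_eqF.
  by rewrite -mulrA ltr_pM2l.
by nra.
Qed.

(* Around a crowded ball, one of A concentric shells contains at most n / A
   points. The points J outside of it hardly interact with those inside, and the
   lower bound on the energy of both groups makes J small. *)
Lemma core_decomposition : exists R0 eps1 : R, 0 < eps1 /\
  forall eps : R, 0 < eps -> eps <= eps1 -> exists n0 : nat,
  forall s : seq V, (n0 <= size s)%N -> pairwise adm s ->
    pairsum f s <= - (B - eps) * (size s)%:R ^+ 2 ->
  exists p I J, [/\ perm_eq s (I ++ J), pairwise adm I, forall x, x \in I -> `|x - p| <= R0,
    (size J)%:R <= 6 * eps / B * (size s)%:R &
    pairsum f I <= pairsum f s + B / 8 * (size J)%:R * (size s)%:R].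
Proof.
have [eta etaE] : exists eta, eta = B / 24 by exists (B / 24).
have eta0 : 0 < eta by rewrite etaE divr_gt0.
have [r r0 far] := f_far eta0.
have [al alE] : exists al, al = B / c by exists (B / c).
have al0 : 0 < al by rewrite alE divr_gt0.
(* With this value, B |s1| |J| <= 3 tau n ^ 2 and |s1| >= al n give |J| <= (al / 24) n, that is, c
   |J| <= (B / 24) n. *)
have [tau tauE] : exists tau, tau = B * al ^+ 2 / 72 by exists (B * al ^+ 2 / 72).
have tau0 : 0 < tau by rewrite tauE divr_gt0// mulr_gt0// exprn_gt0.
(* [A] is so large that the at most n / A points of a shell have a negligible interaction with all
   the others. *)
have [A A0 [cA1 cA2]] : exists2 A : nat, (0 < A)%N & c / A%:R <= B / 24 /\ c / A%:R <= tau.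
  have [A hA] := exists_nat_ge (c * (24 / B) + c / tau).
  have A0 : 0 < A%:R :> R.
    by apply: lt_le_trans hA; rewrite addr_gt0// ?mulr_gt0// ?divr_gt0// invr_gt0.
  exists A; first by rewrite -(ltr0n R).
  have h1 : c * (24 / B) <= A%:R by apply: le_trans hA; rewrite lerDl ltW// divr_gt0.
  have h2 : c / tau <= A%:R by apply: le_trans hA; rewrite lerDr ltW// mulr_gt0// divr_gt0.
  split; rewrite ler_pdivrMr//.
    by rewrite mulrAC ler_pdivlMr// -ler_pdivrMl// mulrC -mulrA.
  by rewrite -ler_pdivrMl// mulrC.
(* The outer radius of the selected shell is [a.+2%:R * r] with [a < A], which gives the radius
   here. The bound on [eps] is what [crowded_ball] (B / 4) and [split_cost_bound] (tau / 2)
   require. *)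
exists (A.+1%:R * r), (Num.min (B / 4) (tau / 2)); split.
  by rewrite lt_min; apply/andP; split; exact: divr_gt0.
move=> eps eps0; rewrite le_min => /andP[epsB epst].
have etau : 2 * eps <= tau by rewrite mulrC -ler_pdivlMr.
have etaB : eta <= B by rewrite etaE ler_pdivrMr// ler_peMr ?ler1n// ltW.
have eps_eta : eps + eta <= B / 2 by rewrite etaE; move: (B_gt0); lra.
have [C0 lb0] := pairsum_lb eps0.
pose C := Num.max C0 0.
have C_ge0 : 0 <= C by rewrite le_max lexx orbT.
have lb s : pairwise adm s -> - (B + eps) * (size s)%:R ^+ 2 - C <= pairsum f s.
  by move/lb0; apply: le_trans; rewrite lerD2l lerN2 le_max lexx.
have [n0 n0P] := exists_nat_ge (2 * C / tau + C / eps + 1).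
exists n0 => s n0s adms Ps.
have ns : 2 * C / tau + C / eps + 1 <= (size s)%:R by apply: le_trans n0P _; rewrite ler_nat.
have e1 : 0 <= 2 * C / tau by apply: divr_ge0; [exact: mulr_ge0|exact: ltW].
have e2 : 0 <= C / eps by apply: divr_ge0 => //; exact: ltW.
have n1 : 1 <= (size s)%:R :> R by apply: le_trans ns; lra.
have hC1 : 2 * C <= tau * (size s)%:R ^+ 2.
  have : 2 * C / tau <= (size s)%:R by apply: le_trans ns; lra.
  by rewrite ler_pdivrMr// => h; nra.
have hC2 : C <= eps * (size s)%:R ^+ 2.
  have : C / eps <= (size s)%:R by apply: le_trans ns; lra.
  by rewrite ler_pdivrMr// => h; nra.
have s0 : (0 < size s)%N by rewrite -(ler1n R).
have [p ps crowd] := crowded_ball eta0 eps_eta far s0 Ps.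
pose m a := count (fun y => `|p - y| <= a.+1%:R * r) s.
have [a aA ma] := @small_increment R A m (size s) A0 (count_size _ _).
pose close b := fun y => `|p - y| <= b%:R * r.
(* [s1] lies in the ball of radius (a + 1) r, which contains the crowded one even for a = 0; [s3] is
   the shell up to (a + 2) r and [J] the outside. The shell has width r, so points of [s1] and of
   [J] are more than r apart. *)
pose I := seq.filter (close a.+2) s; pose J := seq.filter (predC (close a.+2)) s.
pose s1 := seq.filter (close a.+1) I; pose s3 := seq.filter (predC (close a.+1)) I.
have sIJ : perm_eq s (I ++ J) by rewrite perm_sym perm_filterC.
have I13 : perm_eq I (s1 ++ s3) by rewrite perm_sym perm_filterC.
have admI : pairwise adm I by exact: pairwise_filter.
have nIJ : (size s)%:R = (size I)%:R + (size J)%:R :> R.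
  by rewrite -natrD -size_cat (perm_size sIJ).
have n13 : (size I)%:R = (size s1)%:R + (size s3)%:R :> R.
  by rewrite -natrD -size_cat (perm_size I13).
have ns1 : size s1 = m a.
  rewrite size_filter count_filter; apply: eq_count => y /=.
  rewrite /close andb_idr// => /le_trans; apply.
  by rewrite ler_wpM2r ?ler_nat// ltW.
rewrite -alE in crowd.
have al_s1 : al * (size s)%:R <= (size s1)%:R.
  apply: le_trans crowd _; rewrite ns1 ler_nat; apply: sub_count => y /= /le_trans; apply.
  by rewrite ler_peMl ?ler1n// ltW.
have n3 : (size s3)%:R <= (size s)%:R / A%:R :> R.
  apply: le_trans ma; rewrite -ns1 (_ : m a.+1 = size I); last by rewrite size_filter.
  by rewrite n13; lra.
have X12 : - eta * (size s1)%:R * (size J)%:R <= crosssum f s1 J.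
  rewrite [leLHS](_ : _ = (size s1)%:R * (size J)%:R * - eta); last by ring.
  apply: ler_crosssum => x y; rewrite !mem_filter => /andP[xn _] /andP[/= yn _].
  apply: far; move: xn yn; rewrite /close -ltNge => xn yn.
  have := ler_normD (p - x) (x - y); rewrite addrA subrK => h.
  by move: yn; rewrite -[a.+2%:R]natr1 mulrDl mul1r; lra.
have X13 : - c * (size s1)%:R * (size s3)%:R <= crosssum f s1 s3.
  rewrite [leLHS](_ : _ = (size s1)%:R * (size s3)%:R * - c); last by ring.
  exact: ler_crosssum.
have X32 : - c * (size s3)%:R * (size J)%:R <= crosssum f s3 J.
  rewrite [leLHS](_ : _ = (size s3)%:R * (size J)%:R * - c); last by ring.
  exact: ler_crosssum.
have nc0 : - c <= 0 by rewrite oppr_le0 ltW.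
have P3 := ler_pairsum_cst s3 nc0 f_ge.
have P2' := ler_pairsum_cst J nc0 f_ge.
have P1 := lb _ (pairwise_filter (close a.+1) admI).
have P2 := lb _ (pairwise_filter (predC (close a.+2)) adms).
have PI := lb _ admI.
have EI : pairsum f I = pairsum f s1 + crosssum f s1 s3 + pairsum f s3.
  by rewrite (pairsum_perm fN I13) pairsum_cat.
have Es : pairsum f s = pairsum f I + (crosssum f s1 J + crosssum f s3 J) + pairsum f J.
  rewrite (pairsum_perm fN sIJ) pairsum_cat; congr (_ + _ + _).
  rewrite -crosssum_catl [LHS]crosssumC// [RHS]crosssumC//.
  by apply: eq_bigr => x _; apply: perm_big.
have x20 := ler0n R (size J).
have cs3 t : c / A%:R <= t -> c * (size s3)%:R <= t * (size s)%:R.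
  move=> h; have : c * (size s3)%:R <= c * ((size s)%:R / A%:R) by rewrite ler_pM2l.
  by rewrite mulrA mulrAC => /le_trans; apply; rewrite ler_wpM2r.
have h3 := cs3 _ cA1; have h3' := cs3 _ cA2.
(* The lower bounds of all the pieces are summed and compared with the upper bound [Ps] on the
   total. *)
have hx12 : B * ((size s1)%:R * (size J)%:R) <= 3 * tau * (size s)%:R ^+ 2.
  apply: (@split_cost_bound R _ _ (size s3)%:R _ eps tau eta C B c); rewrite ?ler0n ?(ltW c_gt0) ?(ltW eps0) ?(ltW B_gt0)//.
  - by rewrite nIJ n13.
  - by apply: le_trans Ps; rewrite Es EI lerD// lerD ?lerD.
have hJ : c * (size J)%:R <= B / 24 * (size s)%:R.
  have : B * (al * (size s)%:R * (size J)%:R) <= 3 * tau * (size s)%:R ^+ 2.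
    by apply: le_trans hx12; rewrite ler_pM2l// ler_wpM2r.
  rewrite [leLHS](_ : _ = (B * al * (size s)%:R) * (size J)%:R); last by ring.
  rewrite [leRHS](_ : _ = (B * al * (size s)%:R) * (al / 24 * (size s)%:R)); last first.
    by rewrite tauE; field.
  rewrite ler_pM2l ?mulr_gt0 ?ltr0n//.
  move=> h; apply: le_trans (_ : c * (al / 24 * (size s)%:R) <= _); first by rewrite ler_pM2l.
  by rewrite alE le_eqVlt; apply/orP; left; apply/eqP; field; rewrite gt_eqF.
have x1n : (size s1)%:R <= (size s)%:R :> R by rewrite nIJ n13 -addrA lerDl addr_ge0.
have hI : pairsum f I <= pairsum f s + B / 8 * (size J)%:R * (size s)%:R.
  rewrite etaE in X12; have := outer_cost_bound (ltW B_gt0) x20 (ler0n _ _) x1n h3 hJ X12 X32 P2'.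
  by rewrite Es -!addrA lerDl !addrA.
exists p, I, J; split=> //.
- move=> x; rewrite mem_filter => /andP[xp _]; rewrite distrC; apply: le_trans xp _.
  by rewrite ler_pM2r// ler_nat.
- have n20 := ler0n R (size J); rewrite mulrAC ler_pdivlMr//.
  rewrite (_ : (size I)%:R = (size s)%:R - (size J)%:R) in PI; last by rewrite nIJ addrK.
  apply: outer_size_bound PI hI Ps => //; first by rewrite nIJ lerDr.
  by rewrite ltr0n.
Qed.

End core.

(** * Asymptotics of the minimal energy *)

Section ground_constant.
Context {R : realType} {V : zmodType}.
Variables (f : V -> R) (adm : rel V) (c b0 : R).
Hypotheses (c_ge0 : 0 <= c) (b0_gt0 : 0 < b0).
Hypothesis fN : forall x, f (- x) = f x.
Hypothesis f_ge : forall x, - c <= f x.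
Hypothesis f_neg : forall n : nat, exists s : seq V,
  [/\ size s = n, pairwise adm s & pairsum f s <= - b0 * (n%:R * (n%:R - 1))].

Lemma sum_pairsum_rem (s : seq V) :
  \sum_(x <- s) pairsum f (rem x s) = ((size s)%:R - 2) * pairsum f s.
Proof.
(* The row sum of [x] runs over all of [s], including [x] itself, whence the correction by [f 0]. *)
transitivity (\sum_(x <- s) (pairsum f s - (\sum_(y <- s) f (x - y) - f 0))).
  apply: eq_big_seq => x xs; rewrite (pairsum_perm fN (perm_to_rem xs)) /=.
  by rewrite (perm_big _ (perm_to_rem xs)) big_cons /= subrr; ring.
rewrite sumrB sumrB !sumr_const_seq -/(crosssum f s s) crosssum_diag//.
by rewrite addrK mulrBl -[_ *+ size s]mulr_natl -[_ *+ 2]mulr_natl.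
Qed.

(** Dividing by n (n - 1), and not by n ^ 2, is what makes the bound pass exactly from n to n +
    1. *)
Definition quadratic_lb (n : nat) (b : R) := forall s : seq V,
  size s = n -> pairwise adm s -> - b * (n%:R * (n%:R - 1)) <= pairsum f s.

(* Each pair of points survives in n - 1 of the n + 1 lists obtained by removing
   one point. *)
Lemma quadratic_lbS n b : (1 < n)%N -> quadratic_lb n b -> quadratic_lb n.+1 b.
Proof.
move=> n1 lb s sn adms.
have : \sum_(x <- s) (- b * (n%:R * (n%:R - 1))) <= \sum_(x <- s) pairsum f (rem x s).
  rewrite big_seq [leRHS]big_seq ler_sum// => x xs; apply: lb.
    by rewrite size_rem// sn.
  exact: subseq_pairwise (rem_subseq _ _) adms.
rewrite sum_pairsum_rem sumr_const_seq sn -[_ *+ n.+1]mulr_natr -[n.+1%:R]natr1.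
have n1' : 0 < n%:R - 1 :> R by rewrite subr_gt0 ltr1n.
rewrite (_ : n%:R + 1 - 2 = n%:R - 1); last by ring.
rewrite [leLHS](_ : _ = (n%:R - 1) * (- b * ((n%:R + 1) * (n%:R + 1 - 1)))); last by ring.
by rewrite ler_pM2l.
Qed.

Lemma quadratic_lb_le m n b :
  (1 < m)%N -> (m <= n)%N -> quadratic_lb m b -> quadratic_lb n b.
Proof.
move=> m1 mn lb; elim: n mn => [|n IHn]; first by rewrite leqn0 => /eqP mE; move: m1; rewrite mE.
rewrite leq_eqVlt => /predU1P[<-//|mn].
by apply: quadratic_lbS; [exact: leq_trans m1 mn|exact: IHn].
Qed.

(** Lower bound: a constant close to [B] is valid for one size, hence for all larger ones by
    monotonicity, and [C] absorbs the smaller sizes. Upper bound: a constant below [B] is valid for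
    no size greater than 1, so every such size has a configuration that violates it. *)
Lemma ground_constant : exists B : R, [/\ 0 < B,
  (forall eps : R, 0 < eps -> exists C : R, forall s, pairwise adm s ->
     - (B + eps) * (size s)%:R ^+ 2 - C <= pairsum f s) &
  (forall eps : R, 0 < eps -> exists n0 : nat, forall n, (n0 <= n)%N ->
     exists s, [/\ size s = n, pairwise adm s &
       pairsum f s <= - (B - eps) * (size s)%:R ^+ 2])].
Proof.
(* [inf S] is minus the limit of the nondecreasing sequence inf P / (n (n - 1)). It is positive
   because [f_neg] makes [b0] a lower bound of [S]. *)
pose S := [set b | exists2 n, (1 < n)%N & quadratic_lb n b].
have Sb0 : lbound S b0.
  move=> b [n n1 lb]; have [s [sn adms Ps]] := f_neg n.
  have := le_trans (lb s sn adms) Ps.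
  have n1' : 0 < n%:R - 1 :> R by rewrite subr_gt0 ltr1n.
  have n0 : 0 < n%:R :> R by rewrite ltr0n ltnW.
  by rewrite ler_pM2r ?mulr_gt0// lerN2.
have nc0 : - c <= 0 by rewrite oppr_le0.
have S0 : S c.
  exists 2%N => // s s2 _; apply: le_trans (ler_pairsum_cst s nc0 f_ge).
  by rewrite s2 expr2; lra.
have hS : has_inf S by split; [exists c|exists b0].
pose B := inf S.
have B0 : 0 < B by apply: lt_le_trans b0_gt0 _; apply: lb_le_inf => //; exists c.
exists B; split=> // eps eps0.
- have [b [n0 n01 lb] bB] := inf_adherent eps0 hS.
  exists (n0%:R ^+ 2 / 2 * c) => s adms.
  have [ns|ns] := leqP n0 (size s).
    have := quadratic_lb_le n01 ns lb erefl adms; apply: le_trans.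
    have s1 : 1 <= (size s)%:R :> R by rewrite ler1n (leq_trans _ ns)// ltnW.
    have : 0 <= n0%:R ^+ 2 / 2 * c by rewrite mulr_ge0// divr_ge0// sqr_ge0.
    have /Sb0/(lt_le_trans b0_gt0) : S b by exists n0.
    rewrite -/B in bB; move: s1 bB; set n : R := (size s)%:R => s1 bB b_gt0.
    have : b * n ^+ 2 <= (B + eps) * n ^+ 2 by rewrite ler_wpM2r ?sqr_ge0// ltW.
    nra.
  apply: le_trans (ler_pairsum_cst s nc0 f_ge).
  have : (size s)%:R ^+ 2 <= n0%:R ^+ 2 :> R by rewrite ler_sqr ?nnegrE// ler_nat ltnW.
  have := sqr_ge0 ((size s)%:R : R); set n := _ ^+ 2; set m := _ ^+ 2; nra.
(* The other half of [eps] pays for replacing n (n - 1) by n ^ 2, which requires n >= 2 B / eps. *)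
- have [n0 n0P] := exists_nat_ge (2 * B / eps); exists (maxn 2 n0) => n.
  rewrite geq_max => /andP[n2 n0n].
  have nS : ~ S (B - eps / 2).
    move=> /(inf_lbound hS.2); rewrite -/B => h; move: h; have : 0 < eps / 2 by rewrite divr_gt0.
    by lra.
  have /existsNP[s /not_implyP[sn /not_implyP[adms /negP]]] : ~ quadratic_lb n (B - eps / 2).
    by move=> lb; apply: nS; exists n.
  rewrite -ltNge => Ps; exists s; split=> //; apply: le_trans (ltW Ps) _; rewrite sn.
  have : 2 * B / eps <= n%:R by apply: le_trans n0P _; rewrite ler_nat.
  rewrite ler_pdivrMr// => h.
  have n0' : 0 <= n%:R :> R by [].
  have : 0 <= n%:R * (n%:R * eps - 2 * B) by rewrite mulr_ge0// subr_ge0.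
  have : 0 <= n%:R * eps by rewrite mulr_ge0// ltW.
  nra.
Qed.

End ground_constant.

(** * Extended-valued pair sums and averages *)

Section pairsum_ereal.
Context {R : realType} {V : zmodType}.
Implicit Types (k : V -> \bar R) (s t : seq V).
Local Open Scope ereal_scope.

(* Energies are computed with fine \o k, which takes the junk value 0 where k is
   infinite; they are meaningful on lists that are pairwise related by fin_rel. *)
Definition fin_rel k : rel V := fun x y => k (x - y)%R \is a fin_num.

Lemma adde_gtNy (x y : \bar R) : -oo < x -> -oo < y -> -oo < x + y.
Proof. by case: x => [r| |]//; case: y => [r'| |]// _ _; rewrite -EFinD ltNyr. Qed.

Lemma adde_lty_fin (x y : \bar R) : -oo < x -> -oo < y ->
  (x + y < +oo) = (x \is a fin_num) && (y \is a fin_num).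
Proof. by case: x => [r| |]//; case: y => [r'| |]// _ _; rewrite -EFinD ltry. Qed.

Lemma sume_gtNy (I : Type) (s : seq I) (P : pred I) (F : I -> \bar R) :
  (forall i, -oo < F i) -> -oo < \sum_(i <- s | P i) F i.
Proof.
by move=> F_gt; elim/big_rec: _ => [|i x _]; [exact: ltNy0|exact: adde_gtNy].
Qed.

Lemma pairsum_gtNy k s : (forall x, -oo < k x) -> -oo < pairsum k s.
Proof.
move=> k_gt; elim: s => [|x s] /=; first exact: ltNy0.
by apply: adde_gtNy; exact: sume_gtNy.
Qed.

Lemma sume_lty_all (I : Type) (s : seq I) (F : I -> \bar R) :
  (forall i, -oo < F i) -> \sum_(i <- s) F i < +oo ->
  all (fun i => F i \is a fin_num) s.
Proof.
move=> F_gt; elim: s => [//|x s IHs]; rewrite big_cons /=.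
rewrite adde_lty_fin ?sume_gtNy// => /andP[-> sfin] /=.
by apply: IHs; rewrite ltey_eq sfin.
Qed.

Lemma pairsum_lty k s : (forall x, -oo < k x) -> pairsum k s < +oo ->
  pairwise (fin_rel k) s.
Proof.
move=> k_gt; elim: s => //= x s IHs.
rewrite adde_lty_fin ?sume_gtNy ?pairsum_gtNy// => /andP[xs ss].
rewrite IHs ?ltey_eq ?ss// andbT.
by apply: (@sume_lty_all _ s (fun y => k (x - y)%R)) => //; rewrite ltey_eq xs.
Qed.

Lemma pairsum_fine k s : pairwise (fin_rel k) s ->
  pairsum k s = (pairsum (fine \o k) s)%:E.
Proof.
elim: s => //= x s IHs /andP[xs /IHs ->]; rewrite EFinD -sumEFin; congr (_ + _).
rewrite big_seq_cond [RHS]big_seq_cond; apply: eq_bigr => y /andP[ys _].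
by rewrite /= fineK//; exact: (allP xs).
Qed.

End pairsum_ereal.

Section average.
Context d (T : measurableType d) {R : realType}.
Local Open Scope ereal_scope.

(** If [phi] exceeded its average [a] everywhere, then [phi - a] would be positive with zero
    integral, hence zero almost everywhere on [D], which has positive measure. The negation itself
    forces the integral to be finite. *)
Lemma exists_le_average (mu : {measure set T -> \bar R}) (D : set T) (phi : T -> \bar R) :
  measurable D -> 0 < mu D -> mu D < +oo -> measurable_fun D phi ->
  (forall x, D x -> 0 <= phi x) ->
  exists2 x, D x & phi x * mu D <= \int[mu]_(x in D) phi x.
Proof.
move=> mD D0 Doo mphi phi0; apply: contrapT => /forall2NP H.
set I := \int[mu]_(x in D) phi x in H.
have Dfin : mu D \is a fin_num by rewrite ge0_fin_numE.
have {}H x : D x -> I < phi x * mu D.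
  by move=> Dx; have [//|/negP] := H x; rewrite -ltNge.
have I0 : 0 <= I by exact: integral_ge0.
have [x0 Dx0] : D !=set0.
  by apply/set0P/eqP => DE; move: D0; rewrite DE measure0 ltxx.
have Ifin : I \is a fin_num by rewrite ge0_fin_numE// (lt_le_trans (H _ Dx0))// leey.
pose a := (fine I / fine (mu D))%R.
have mD0 : (0 < fine (mu D))%R by rewrite fine_gt0// D0.
have aI : a%:E * mu D = I.
  by rewrite -[mu D]fineK// -EFinM /a divfK ?gt_eqF// fineK.
have a0 : (0 <= a)%R by rewrite divr_ge0// fine_ge0.
have phia x : D x -> a%:E < phi x.
  move=> /H; rewrite -aI; apply: contraTT; rewrite -!leNgt => h.
  by rewrite lee_pmul2r.
have mphia : measurable_fun D (fun x => phi x - a%:E).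
  by apply: emeasurable_funB => //; exact: measurable_cst.
have phia0 x : D x -> 0 <= phi x - a%:E by move=> /phia/ltW; rewrite sube_ge0.
have psi_ae : ae_eq mu D (fun x => phi x - a%:E) (cst 0).
  apply/ae_eq_integral_abs => //.
  have : I = \int[mu]_(x in D) (phi x - a%:E) + I.
    rewrite -[in RHS]aI -integral_cst// -ge0_integralD//.
      by apply: eq_integral => x _; rewrite subeK.
  have -> : \int[mu]_(x in D) `|phi x - a%:E| = \int[mu]_(x in D) (phi x - a%:E).
    by apply: eq_integral => x /set_mem Dx; rewrite gee0_abs// phia0.
  have : 0 <= \int[mu]_(x in D) (phi x - a%:E) by exact: integral_ge0.
  rewrite -(fineK Ifin); case: (\int[mu]_(x in D) _) => // s _ [rE].
  by congr EFin; lra.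
have : mu.-negligible D.
  apply: negligibleS psi_ae => x Dx /= /(_ Dx) h.
  by move: (phia x Dx); rewrite -sube_gt0 h ltxx.
by move=> /(measure_negligible mD) DE; move: D0; rewrite DE ltxx.
Qed.

End average.

(** * Negative energy of random samples *)

Section sampling.
Context {R : realType} {N : nat}.
Variables (mu : probability 'rV[R]_N R) (h : 'rV[R]_N -> \bar R).
Local Open Scope ereal_scope.
Hypothesis h_ge0 : forall x, 0 <= h x.
Hypothesis mh : measurable_fun setT (fun p : 'rV[R]_N * 'rV[R]_N => h (p.1 - p.2)%R).

Let V y := \int[mu]_x h (x - y)%R.

Let V_ge0 y : 0 <= V y. Proof. exact: integral_ge0. Qed.

Let mV : measurable_fun setT V.
Proof. exact: (measurable_fun_fubini_tonelli_G (m1 := mu) _ mh). Qed.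

Let mhy (y : 'rV[R]_N) : measurable_fun setT (fun x : 'rV[R]_N => h (x - y)%R).
Proof. exact: (measurableT_comp mh (pair2_measurable y)). Qed.

(* Points are chosen one at a time; the right-hand side is the expectation of
   the energy when the k remaining points are independent with law mu. *)
Lemma sample_pairsum_le (k : nat) (s : seq 'rV[R]_N) : exists2 t, size t = k &
  pairsum h (t ++ s) <=
    (pairsum h s + (\sum_(y <- s) V y) *+ k + (\int[mu]_y V y)%E *+ 'C(k, 2))%R.
Proof.
elim: k s => [|k IHk] s; first by exists [::]; rewrite //= !addr0.
(* [phi x] is the interaction of [x] with the points already chosen plus its expected interaction
   with the [k] points still to come; [x] is taken below the mean of [phi]. *)
pose phi (x : 'rV[R]_N) := \sum_(y <- s) h (x - y)%R + \sum_(i <- iota 0 k) V x.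
have sum_h0 x : 0 <= \sum_(y <- s) h (x - y)%R by exact: sume_ge0.
have sum_V0 x : 0 <= \sum_(i <- iota 0 k) V x by exact: sume_ge0.
have m1 : measurable_fun setT (fun x : 'rV[R]_N => \sum_(y <- s) h (x - y)%R).
  exact: emeasurable_sum.
have m2 : measurable_fun setT (fun x : 'rV[R]_N => \sum_(i <- iota 0 k) V x).
  exact: emeasurable_sum.
have mphi : measurable_fun setT phi by exact: emeasurable_funD.
have muT : mu setT = 1 by exact: probability_setT.
have [|||x _] := @exists_le_average _ _ _ mu setT phi measurableT _ _ mphi.
- by rewrite [X in _ < X]muT.
- by rewrite [X in X < _]muT ltry.
- by move=> x _; exact: adde_ge0.
rewrite [X in _ * X]muT mule1 ge0_integralD// !ge0_integral_sum//.
rewrite sumr_const_seq size_iota /phi sumr_const_seq size_iota => phix.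
have [t tk Pt] := IHk (x :: s); exists (rcons t x); first by rewrite size_rcons tk.
rewrite cat_rcons; apply: le_trans Pt _; rewrite /= big_cons mulrnDl binS bin1 mulrnDr mulrS.
set A := \sum_(y <- s) h (x - y)%R in phix *.
set S := \sum_(y <- s) V y in phix *; set E := \int[mu]_y V y in phix *.
rewrite [leLHS](_ : _ = ((A + V x *+ k) + (pairsum h s + S *+ k + E *+ 'C(k, 2)))%R); last first.
  by rewrite [LHS](AC (2*2*1) ((1*3)*(2*4*5))).
rewrite [leRHS](_ : _ = ((S + E *+ k) + (pairsum h s + S *+ k + E *+ 'C(k, 2)))%R); last first.
  by rewrite [LHS](AC (1*2*2) ((2*5)*(1*3*4))).
exact: leeD2r.
Qed.

End sampling.

Section integral_shift.
Local Open Scope ereal_scope.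

(** The integral of [phi] may be [+oo], but its negative part is at most [c], hence integrable: one
    integrates the identity (phi + c) + phi^- = phi^+ + c between nonnegative functions. *)
Lemma integral_shift d (T : measurableType d) (R : realType) (P : probability T R)
    (phi : T -> \bar R) (c : R) :
  (0 <= c)%R -> measurable_fun setT phi -> (forall x, (- c)%:E <= phi x) ->
  \int[P]_x (phi x + c%:E) = \int[P]_x phi x + c%:E.
Proof.
move=> c0 mphi phic.
have phic0 x : 0 <= phi x + c%:E by rewrite -leeBlDr ?sub0e.
have neg_c x : phi^\- x <= c%:E.
  by rewrite funenegE ge_max lee_fin c0 andbT leeNl -EFinN.
have c_int : \int[P]_x (cst c%:E) x = c%:E by rewrite integral_cst// [X in _ * X](@probability_setT _ _ _ P) mule1.
have negfin : \int[P]_x phi^\- x \is a fin_num.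
  rewrite ge0_fin_numE ?integral_ge0//; apply: le_lt_trans (ltry c).
  by rewrite -c_int ge0_le_integral//; exact: measurable_funeneg.
have : \int[P]_x (phi x + c%:E) + \int[P]_x phi^\- x = \int[P]_x phi^\+ x + c%:E.
  rewrite -[X in _ = _ + X]c_int -!ge0_integralD//.
  - apply: eq_integral => x _ /=; rewrite funeposE funenegE.
    have := phic x; case: (phi x) => [r| |]//= _; last by rewrite maxye maxNye adde0.
    by rewrite -!EFin_max -!EFinD /=; congr EFin; rewrite /Num.max; case: ifP; case: ifP => *; lra.
  - exact: measurable_funepos.
  - by apply: emeasurable_funD.
  - exact: measurable_funeneg.
rewrite [\int[P]_x phi x]integralE.
case: (\int[P]_x phi^\- x) negfin => // r _.
have : 0 <= \int[P]_x (phi x + c%:E) by exact: integral_ge0.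
have : 0 <= \int[P]_x phi^\+ x by exact: integral_ge0.
case: (\int[P]_x phi^\+ x) => [s| |]//; case: (\int[P]_x (phi x + c%:E)) => [t| |]// _ _.
by rewrite -!EFinD => -[] e; congr EFin; lra.
Qed.

End integral_shift.

Section negative_configurations.
Context {R : realType} {N : nat}.
Variables (g : 'rV[R]_N -> \bar R) (c : R).
Hypotheses (c_ge0 : 0 <= c) (g_ge : forall x, ((- c)%:E <= g x)%E).
Hypothesis g_lsc : lower_semicontinuous g.
Local Open Scope ereal_scope.

Lemma lsc_measurable_mx : measurable_fun setT g.
Proof.
apply: (measurability _ (ErealGenOInfty.measurableE R)).
move=> /= _ [_ [a ->]] <-; rewrite setTI; apply: open_measurable_mx.
by rewrite preimage_itvoy; move/lower_semicontinuousP : g_lsc; exact.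
Qed.

Lemma measurable_subr_mx :
  measurable_fun setT (fun p : 'rV[R]_N * 'rV[R]_N => (p.1 - p.2)%R).
Proof.
apply: measurable_fun_mx => i j.
rewrite (_ : (fun _ => _) = (fun p : 'rV[R]_N * 'rV[R]_N => p.1 i j - p.2 i j)%R).
  apply: measurable_funB.
    exact: (measurableT_comp (measurable_coord i j) measurable_fst).
  exact: (measurableT_comp (measurable_coord i j) measurable_snd).
by apply/funext => p; rewrite !mxE.
Qed.

(** Sampling is applied to the nonnegative kernel g + c, and the constant is then subtracted from
    every pair. A finite energy of the sample also yields admissibility. *)
Lemma negative_configurations (mu : probability 'rV[R]_N R) :
  energy g mu < 0 -> exists2 b0 : R, (0 < b0)%R & forall n : nat,
    exists s : seq 'rV[R]_N, [/\ size s = n, pairwise (fin_rel g) s &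
      pairsum (fine \o g) s <= - b0 * (n%:R * (n%:R - 1)) :> R]%R.
Proof.
move=> Eg.
pose h x := g x + c%:E.
have mg (p : 'rV[R]_N * 'rV[R]_N -> 'rV[R]_N) : measurable_fun setT p ->
    measurable_fun setT (g \o p).
  by move=> mp; apply: measurableT_comp => //; exact: lsc_measurable_mx.
have h0 x : 0 <= h x by rewrite /h -leeBlDr ?sub0e.
have mh : measurable_fun setT (fun p : 'rV[R]_N * 'rV[R]_N => h (p.1 - p.2)%R).
  by apply: emeasurable_funD => //; exact: (mg _ measurable_subr_mx).
have mgy (y : 'rV[R]_N) : measurable_fun setT (fun x : 'rV[R]_N => g (x - y)%R).
  exact: (measurableT_comp (mg _ measurable_subr_mx) (pair2_measurable y)).
have Eh : \int[mu]_y \int[mu]_x h (x - y)%R = energy g mu + c%:E.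
  have hg y : \int[mu]_x h (x - y)%R = \int[mu]_x g (x - y)%R + c%:E.
    exact: integral_shift.
  rewrite /energy -integral_shift//.
  - by apply: eq_integral => y _; rewrite hg.
  - have := measurable_fun_fubini_tonelli_G (m1 := mu) _ mh (fun p => h0 _).
    rewrite /fubini_G => mG.
    rewrite (_ : (fun _ => _) = fun y => \int[mu]_x h (x - y)%R - c%:E).
      by apply: emeasurable_funB => //; exact: measurable_cst.
    by apply/funext => y; rewrite hg addeK.
  - move=> y; have : 0 <= \int[mu]_x h (x - y)%R by exact: integral_ge0.
    by rewrite hg -leeBlDr// sub0e.
have Eh0 : 0 <= energy g mu + c%:E.
  by rewrite -Eh; apply: integral_ge0 => y _; exact: integral_ge0.
have [e eE] : exists e : R, energy g mu = e%:E.
  by case: (energy g mu) Eg Eh0 => // r _ _; exists r.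
rewrite eE in Eg Eh.
(* Each of the n (n - 1) / 2 pairs has expected energy [e]. *)
exists (- e / 2)%R => [|n]; first by rewrite divr_gt0// oppr_gt0 -lte_fin.
have [s sn] := sample_pairsum_le mu h0 mh n [::].
rewrite cats0 big_nil mul0rn addr0 add0r Eh => Ps.
have EFin_mulrn (r : R) k : (r%:E *+ k)%R = (r *+ k)%:E.
  by elim: k => //= k IHk; rewrite !mulrS IHk.
rewrite -EFinD EFin_mulrn in Ps.
have h_gt x : -oo < h x by exact: lt_le_trans (h0 x).
have hs := pairsum_lty h_gt (le_lt_trans Ps (ltry _)).
have gs : pairwise (fin_rel g) s.
  by apply: sub_pairwise hs => x y; rewrite /fin_rel /h fin_numD => /andP[].
exists s; split=> //.
have cs : pairwise (fin_rel (fun=> c%:E)) s.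
  by elim: (s) => //= x t ->; rewrite andbT; apply/allP.
move: Ps; rewrite (pairsumD g (fun=> c%:E)) (pairsum_fine gs) (pairsum_fine cs) -EFinD lee_fin.
rewrite (_ : fine \o (fun=> c%:E) = (fun=> c) :> ('rV[R]_N -> R))// pairsum_cst sn -[(_ *+ 'C(n, 2))%R]mulr_natr.
have -> : ('C(n, 2)%:R = n%:R * (n%:R - 1) / 2 :> R)%R.
  elim: n {sn} => [|m IHm]; first by rewrite !mul0r.
  by rewrite binS bin1 natrD IHm -natr1; field.
lra.
Qed.

End negative_configurations.

(** * Translation invariance of Lebesgue measure *)

Section lebesgue_translation.
Context {R : realType}.
Local Open Scope ereal_scope.

Definition addr_mx {m n : nat} (z x : 'M[R]_(m, n)) := (x + z)%R.

Lemma measurable_addr_mx (m n : nat) (z : 'M[R]_(m, n)) :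
  measurable_fun setT (addr_mx z).
Proof.
apply: measurable_fun_mx => i j.
rewrite (_ : (fun _ => _) = (fun x : 'M[R]_(m, n) => x i j + z i j)%R).
  by apply: measurable_funD; [exact: measurable_coord|exact: measurable_cst].
by apply/funext => p; rewrite /addr_mx !mxE.
Qed.

HB.instance Definition _ m n z :=
  isMeasurableFun.Build _ _ _ _ _ (@measurable_addr_mx m n z).

Definition addr_real (z : R) (x : measurableTypeR R) : measurableTypeR R := (x + z)%R.

Lemma measurable_addr_real z : measurable_fun setT (addr_real z).
Proof. by apply: measurable_funD; [exact: measurable_id|exact: measurable_cst]. Qed.

HB.instance Definition _ z := isMeasurableFun.Build _ _ _ _ _ (measurable_addr_real z).

Lemma lebesgue_measure_shift (z : R) (A : set (measurableTypeR R)) : measurable A ->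
  lebesgue_measure (addr_real z @^-1` A) = lebesgue_measure A.
Proof.
move=> mA.
apply/esym/(@lebesgue_measure_unique _ (pushforward lebesgue_measure (addr_real z))) => //= _ [[a b]] _ <-.
rewrite /pushforward (_ : _ @^-1` _ = `](a - z)%R, (b - z)%R]%classic); last first.
  by apply/seteqP; split=> x; rewrite /addr_real /= !in_itv /= ltrBlDr lerBrDr.
rewrite !lebesgue_measure_itv/= !lte_fin ltrD2r -!EFinD.
by rewrite opprB addrA subrK.
Qed.

Definition addr_pair {n} (z : R * 'rV[R]_n) (p : measurableTypeR R * 'rV[R]_n) :
  measurableTypeR R * 'rV[R]_n := (addr_real z.1 p.1, addr_mx z.2 p.2)%R.

Lemma measurable_addr_pair n (z : R * 'rV[R]_n) : measurable_fun setT (addr_pair z).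
Proof.
apply: measurable_fun_pair.
  exact: (measurableT_comp (measurable_addr_real z.1) measurable_fst).
exact: (measurableT_comp (measurable_addr_mx z.2) measurable_snd).
Qed.

HB.instance Definition _ n z := isMeasurableFun.Build _ _ _ _ _ (@measurable_addr_pair n z).

(** Induction on the dimension: through [cons_rV] the translation acts separately on the first
    coordinate and on the rest, and a product measure is determined by its values on rectangles. *)
Lemma lebesgue_rV_shift n (z : 'rV[R]_n) (A : set 'rV[R]_n) : measurable A ->
  lebesgue_rV n (addr_mx z @^-1` A) = lebesgue_rV n A.
Proof.
elim: n z A => [|n IHn] z A mA /=.
  rewrite (_ : _ @^-1` A = A)//.
  by apply/seteqP; split=> x /=; rewrite /addr_mx [z]thinmx0 addr0.
rewrite /lebesgue_step /pushforward.
pose z' : R * 'rV[R]_n := (z ord0 ord0, @rsubmx _ 1 1 n z).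
have e : addr_mx z \o cons_rV = cons_rV \o addr_pair z'.
  apply/funext => p /=; rewrite /addr_mx /cons_rV.
  have zE : z = row_mx (@lsubmx _ 1 1 n z) (@rsubmx _ 1 1 n z) by rewrite hsubmxK.
  rewrite [X in (_ + X)%R]zE; apply: etrans (@add_row_mx _ 1 1 n _ _ _ _) _.
  congr row_mx; apply/matrixP => i j; rewrite !ord1 !mxE ?eqxx ?mulr1n//=.
  by rewrite /addr_real/=; congr (_ + z _ _)%R; exact/val_inj.
have -> : cons_rV @^-1` (addr_mx z @^-1` A) = addr_pair z' @^-1` (cons_rV @^-1` A).
  exact: (congr1 (fun f => f @^-1` A) e).
symmetry.
apply: (@product_measure_unique _ _ _ _ _ _ _ (pushforward (lebesgue_measure \x lebesgue_rV n) (addr_pair z'))).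
  move=> B C mB mC; rewrite /pushforward.
  transitivity ((lebesgue_measure \x lebesgue_rV n) ((addr_real z'.1 @^-1` B) `*` (addr_mx z'.2 @^-1` C))).
    by [].
  rewrite product_measure1E.
  - by apply: f_equal2; [exact: lebesgue_measure_shift|exact: IHn].
  - by rewrite -[X in measurable X]setTI; exact: measurable_addr_real.
  - by rewrite -[X in measurable X]setTI; exact: measurable_addr_mx.
by rewrite -[X in measurable X]setTI; exact: measurable_cons_rV.
Qed.

Lemma integral_rV_shift n (z : 'rV[R]_n) (K : set 'rV[R]_n) (h : 'rV[R]_n -> \bar R) :
  measurable K -> measurable_fun setT h -> (forall x, 0 <= h x) ->
  \int[lebesgue_rV n]_(x in addr_mx z @^-1` K) h (x + z)%R = \int[lebesgue_rV n]_(x in K) h x.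
Proof.
move=> mK mh h0.
have <- : \int[pushforward (lebesgue_rV n) (addr_mx z)]_(x in K) h x = \int[lebesgue_rV n]_(x in K) h x.
  by apply: eq_measure_integral => A mA _; exact: lebesgue_rV_shift.
by rewrite ge0_integral_pushforward//; exact: measurable_funTS.
Qed.

Lemma measurable_box n (a b : 'I_n -> R) :
  measurable [set v : 'rV[R]_n | forall i, (a i < v ord0 i < b i)%R].
Proof.
rewrite (_ : mkset _ = \bigcap_(i in [set: 'I_n]) ((fun v : 'rV[R]_n => v ord0 i : measurableTypeR R) @^-1` `]a i, b i[)).
  apply: fin_bigcap_measurable => [|i _]; first exact: finite_finset.
  by rewrite -[X in measurable X]setTI; apply: measurable_coord => //; exact: measurable_itv.
by apply/seteqP; split=> v h i => [_|]; have := h i; rewrite /= in_itv/=; [|apply].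
Qed.

Lemma lebesgue_rV_box n (a b : 'I_n -> R) : (forall i, (a i < b i)%R) ->
  lebesgue_rV n [set v : 'rV[R]_n | forall i, (a i < v ord0 i < b i)%R] = (\prod_i (b i - a i))%:E.
Proof.
elim: n a b => [|n IHn] a b ab /=.
  by rewrite big_ord0 diracE mem_set// => -[].
pose a' (i : 'I_n) := a (lift ord0 i); pose b' (i : 'I_n) := b (lift ord0 i).
have cons0 (p : R * 'rV[R]_n) : cons_rV p ord0 ord0 = p.1.
  rewrite (_ : ord0 = @lshift 1 n ord0); last exact/val_inj.
  by apply: etrans (row_mxEl _ _ _ _) _; rewrite mxE eqxx.
have consS (p : R * 'rV[R]_n) (i : 'I_n) : cons_rV p ord0 (lift ord0 i) = p.2 ord0 i.
  rewrite (_ : lift ord0 i = @rshift 1 n i); last exact/val_inj.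
  exact: row_mxEr.
have boxE : cons_rV @^-1` [set v : 'rV[R]_n.+1 | forall i, (a i < v ord0 i < b i)%R] =
    `]a ord0, b ord0[%classic `*` [set v : 'rV[R]_n | forall i, (a' i < v ord0 i < b' i)%R].
  apply/seteqP; split=> [p /= h|p [/= h0 h] i].
    split=> [|i]; first by have := h ord0; rewrite cons0 /= in_itv.
    by have := h (lift ord0 i); rewrite consS.
  case: (unliftP ord0 i) => [j ->|->]; first by rewrite consS; exact: h.
  by rewrite cons0; move: h0; rewrite in_itv.
transitivity ((lebesgue_measure \x lebesgue_rV n) (cons_rV @^-1` [set v : 'rV[R]_n.+1 | forall i, (a i < v ord0 i < b i)%R])).
  by [].
rewrite boxE product_measure1E//; last exact: measurable_box.
rewrite [X in _ * X](IHn a' b') => [|i]; last exact: ab.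
rewrite big_ord_recl EFinM; congr (_ * _).
by apply: etrans (lebesgue_measure_itv `]a ord0, b ord0[) _; rewrite /= lte_fin ab -EFinD.
Qed.

End lebesgue_translation.

(** * Averages of the kernel over a box of translations *)

Section average_over_box.
Context {R : realType} {n : nat}.
Variables (g : 'rV[R]_n -> \bar R) (c : R).
Hypotheses (c_ge0 : 0 <= c) (g_ge : forall x, ((- c)%:E <= g x)%E).
Hypothesis g_lsc : lower_semicontinuous g.
Hypothesis g_L1loc : locally_integrable_rV g.
Local Open Scope ereal_scope.

Lemma coord_le_norm (x : 'rV[R]_n) i : (`|x ord0 i| <= `|x|)%R.
Proof. by rewrite [leRHS]/Num.norm/= mx_normrE; exact: (le_bigmax _ _ (ord0, i)). Qed.

Lemma compact_cball_rV (M : R) : compact [set x : 'rV[R]_n | `|x| <= M]%R.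
Proof.
apply: bounded_closed_compact.
  by exists M; split; [exact: num_real|move=> x Mx y /= yM; exact: le_trans yM (ltW Mx)].
rewrite (_ : mkset _ = closed_ball_ Num.Def.normr (0%R : 'rV[R]_n) M).
  exact: closed_closed_ball_.
by apply/seteqP; split=> x; rewrite /closed_ball_/= sub0r normrN.
Qed.

Lemma integral_cball_lty (M : R) :
  \int[lebesgue_rV n]_(x in [set x | `|x| <= M]%R) (g x + c%:E) < +oo.
Proof.
set K := [set x | _].
have cK : compact K by exact: compact_cball_rV.
have mK : measurable K.
  rewrite -[K]setCK; apply: measurableC; apply: open_measurable_mx; apply: closed_openC.
  exact: (compact_closed (@norm_hausdorff _ _) cK).
have /integrableP[mgK gK] := g_L1loc cK.
have mg : measurable_fun K g by apply: measurable_funTS; exact: lsc_measurable_mx.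
have Koo : lebesgue_rV n K < +oo.
  have M1 (i : 'I_n) : (- (`|M| + 1) < `|M| + 1)%R.
    by have := normr_ge0 M; lra.
  apply: le_lt_trans (ltry (\prod_(i < n) ((`|M| + 1) - - (`|M| + 1)))%R).
  rewrite -(lebesgue_rV_box M1); apply: le_measure; rewrite ?inE//.
    exact: measurable_box.
  move=> x /= xM i; have := le_trans (coord_le_norm x i) xM.
  rewrite ler_norml => /andP[h1 h2].
  have MM : (M < `|M| + 1)%R by rewrite ltr_pwDr// ler_norm.
  by rewrite (le_lt_trans h2 MM) andbT (lt_le_trans _ h1)// ltrN2.
have : \int[lebesgue_rV n]_(x in K) (g x + c%:E) <= \int[lebesgue_rV n]_(x in K) (`|g x| + c%:E).
  apply: ge0_le_integral => //.
  - by move=> x _; rewrite -leeBlDr ?sub0e.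
  - by apply: emeasurable_funD => //; exact: measurable_cst.
  - by apply: emeasurable_funD; [exact: measurableT_comp|exact: measurable_cst].
  - by move=> x _; apply: leeD2r; exact: lee_abs.
move/le_lt_trans; apply; rewrite ge0_integralD//.
- rewrite lte_add_pinfty// integral_cst//.
  by apply: lte_mul_pinfty.
- exact: measurableT_comp.
Qed.

(** For each [z], the integral of g + c over the translated box is at most its integral over the
    ball of radius rho + 1, finite by local integrability. Summing over [zs] and choosing [u] below
    the mean gives a constant that depends only on the box and on [rho], and finiteness of every
    term. *)
Lemma average_shift_bound (a b : 'I_n -> R) (rho : R) :
  (forall i, a i < b i)%R ->
  (forall u : 'rV[R]_n, (forall i, a i < u ord0 i < b i) -> `|u| <= 1)%R ->
  exists2 C : R, (0 <= C)%R & forall zs : seq 'rV[R]_n, (forall z, z \in zs -> `|z| <= rho)%R ->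
  exists u : 'rV[R]_n, [/\ forall i, (a i < u ord0 i < b i)%R,
    (forall z, z \in zs -> g (z + u)%R \is a fin_num) &
    (\sum_(z <- zs) (fine (g (z + u)) + c) <= C * (size zs)%:R)%R].
Proof.
move=> ab D1.
pose D := [set u : 'rV[R]_n | forall i, (a i < u ord0 i < b i)%R].
pose K := [set x : 'rV[R]_n | `|x| <= rho + 1]%R.
have cK : compact K by exact: compact_cball_rV.
have mK : measurable K.
  rewrite -[K]setCK; apply: measurableC; apply: open_measurable_mx; apply: closed_openC.
  exact: (compact_closed (@norm_hausdorff _ _) cK).
have mD : measurable D := measurable_box a b.
pose h x := g x + c%:E.
have h0 x : 0 <= h x by rewrite /h -leeBlDr ?sub0e.
have mh : measurable_fun setT h.
  by apply: emeasurable_funD; [exact: lsc_measurable_mx|exact: measurable_cst].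
have mhz (z : 'rV[R]_n) : measurable_fun D (fun u => h (z + u)%R).
  apply: measurable_funTS.
  have := measurableT_comp mh (measurable_addr_mx z); congr measurable_fun.
  by apply/funext => u; rewrite /= /addr_mx addrC.
pose I := \int[lebesgue_rV n]_(x in K) h x.
have Ioo : I < +oo := integral_cball_lty _.
have I0 : 0 <= I by exact: integral_ge0.
have Ifin : I \is a fin_num by rewrite ge0_fin_numE.
pose vol := (\prod_i (b i - a i))%R.
have vol0 : (0 < vol)%R by apply: prodr_gt0 => i _; rewrite subr_gt0.
have DE : lebesgue_rV n D = vol%:E := lebesgue_rV_box ab.
have hz (z : 'rV[R]_n) : (`|z| <= rho)%R -> \int[lebesgue_rV n]_(u in D) h (z + u)%R <= I.
  move=> zrho; rewrite /I -(integral_rV_shift z mK mh h0).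
  under eq_integral => u _ do rewrite addrC.
  apply: ge0_subset_integral => //.
  - by rewrite -[X in measurable X]setTI; exact: measurable_addr_mx.
  - apply: measurable_funTS; exact: (measurableT_comp mh (measurable_addr_mx z)).
  - move=> u Du; rewrite /addr_mx /=; apply: le_trans (ler_normD _ _) _.
    by rewrite addrC lerD// D1.
exists (fine I / vol)%R => [|zs zsrho]; first by rewrite divr_ge0 ?fine_ge0// ltW.
have [||||u Du] := @exists_le_average _ _ _ (lebesgue_rV n) D (fun u => \sum_(z <- zs) h (z + u)%R) mD.
- by rewrite [X in _ < X]DE lte_fin.
- by rewrite [X in X < _]DE ltry.
- exact: emeasurable_sum.
- by move=> u _; exact: sume_ge0.
rewrite ge0_integral_sum// [X in _ * X]DE => le1.
have le2 : (\sum_(z <- zs) h (z + u)%R) * vol%:E <= (fine I * (size zs)%:R)%:E.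
  apply: le_trans le1 _.
  apply: (@le_trans _ _ (\sum_(z <- zs) (fine I)%:E)).
    rewrite big_seq_cond [leRHS]big_seq_cond; apply: lee_sum => z /andP[zzs _].
    by rewrite fineK// hz// zsrho.
  by rewrite sumEFin sumr_const_seq mulr_natr.
have Soo : \sum_(z <- zs) h (z + u)%R < +oo.
  have S0 : 0 <= \sum_(z <- zs) h (z + u)%R by exact: sume_ge0.
  move: le2 S0; case: (\sum_(z <- zs) _) => [r| |]//; first by rewrite ltry.
  by rewrite gt0_mulye ?lte_fin.
have hgt z : -oo < h (z + u)%R by exact: lt_le_trans (h0 _).
have hfin := sume_lty_all hgt Soo.
have gfin z : z \in zs -> g (z + u)%R \is a fin_num.
  by move=> /(allP hfin); rewrite /h fin_numD => /andP[].
exists u; split=> //.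
rewrite mulrAC ler_pdivlMr// -lee_fin EFinM; apply: le_trans le2.
rewrite -sumEFin le_eqVlt; apply/orP; left; apply/eqP; congr (_ * _).
rewrite big_seq_cond [RHS]big_seq_cond; apply: eq_bigr => z /andP[zzs _].
by rewrite EFinD fineK// gfin.
Qed.

End average_over_box.

(** * Shifting outward *)

Section outward_shift.
Context {R : realType} {N : nat}.
Variables (g : 'rV[R]_N.+1 -> \bar R).
Hypothesis g_fin : forall x, x != 0 -> g x \is a fin_num.
Hypothesis g_cont : {within [set~ (0 : 'rV[R]_N.+1)], continuous g}.
Hypothesis g_decr : exists2 r : R, 0 < r & forall x y : 'rV[R]_N.+1,
  0 < enorm x -> enorm x <= enorm y -> enorm y < r -> (g y <= g x)%E.

Lemma enorm_le (x : 'rV[R]_N.+1) : enorm x <= N.+1%:R * `|x|.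
Proof.
rewrite /enorm -[leRHS]ger0_norm ?mulr_ge0// -sqrtr_sqr ler_sqrt ?sqr_ge0//.
apply: (@le_trans _ _ (\sum_(i < N.+1) `|x| ^+ 2)).
  apply: ler_sum => i _; rewrite -[leLHS]real_normK ?num_real ?ler_sqr ?nnegrE//.
  exact: coord_le_norm.
rewrite sumr_const card_ord exprMn -[leLHS]mulr_natl ler_wpM2r ?sqr_ge0//.
by rewrite -natrX ler_nat expnS leq_pmulr// expn_gt0.
Qed.

Lemma enorm_gt0 (x : 'rV[R]_N.+1) : x != 0 -> 0 < enorm x.
Proof.
move=> x0; rewrite /enorm sqrtr_gt0 lt_neqAle sumr_ge0 ?andbT => [|i _]; last exact: sqr_ge0.
rewrite eq_sym psumr_neq0 => [|i _]; last exact: sqr_ge0.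
have [i xi] : exists i, x ord0 i != 0.
  apply: contrapT => /forallNP h; move/eqP: x0; apply; apply/rowP => i.
  by rewrite mxE; apply/eqP/negP/negP/negPn; have /negP := h i.
by apply/hasP; exists i; rewrite ?mem_index_enum//= lt_neqAle sqr_ge0 eq_sym sqrf_eq0 xi.
Qed.

Lemma fine_continuous (z : 'rV[R]_N.+1) : z != 0 -> {for z, continuous (fine \o g)}.
Proof.
move=> z0; have oA : open [set~ (0 : 'rV[R]_N.+1)].
  exact/closed_openC/accessible_closed_set1/hausdorff_accessible/norm_hausdorff.
have := g_cont; rewrite continuous_open_subspace// => /(_ z).
rewrite inE /= => /(_ (elimN eqP z0)) gz.
apply: (@fine_cvg R _ (nbhs z) (nbhs_filter z)); rewrite /= fineK ?g_fin//.
Qed.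

(** Uniform continuity on a compact annulus that avoids the origin. Since z + u may leave the
    annulus, the covering argument uses neighbourhoods of (z, 0) in the pairs (z, u). *)
Lemma uniform_shift (M rho theta : R) : 0 < M -> 0 < theta ->
  exists2 d : R, 0 < d & forall z u : 'rV[R]_N.+1, M <= `|z| -> `|z| <= rho ->
    `|u| < d -> fine (g (z + u)) <= fine (g z) + theta.
Proof.
move=> M0 theta0.
pose K := [set z : 'rV[R]_N.+1 | `|z| <= rho] `&` ~` [set z : 'rV[R]_N.+1 | `|z| < M].
have cK : compact K.
  apply: (@subclosed_compact _ _ [set z : 'rV[R]_N.+1 | `|z| <= rho]).
  - apply: closedI.
      by apply: compact_closed; [exact: norm_hausdorff|exact: compact_cball_rV].
    apply: open_closedC.
    rewrite (_ : mkset _ = ball (0 : 'rV[R]_N.+1) M); first exact: ball_open.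
    by rewrite -ball_normE; apply/seteqP; split=> z; rewrite /ball_ /= sub0r normrN.
  - exact: compact_cball_rV.
  - by move=> z [].
have ncK := (compact_near_coveringP K).1 cK.
pose P (u z : 'rV[R]_N.+1) := fine (g (z + u)) <= fine (g z) + theta.
have K1 z : K z -> \forall z' \near z & u \near nbhs (0 : 'rV[R]_N.+1), P u z'.
  move=> [_ /= zM].
  have z0 : z != 0 by apply/negP => /eqP z0; apply: zM; rewrite z0 normr0.
  have th2 : 0 < theta / 2 by rewrite divr_gt0.
  have cz := fine_continuous z0.
  have near_z : nbhs z [set y | fine (g z) - theta / 2 < fine (g y) < fine (g z) + theta / 2].
    have lt1 : fine (g z) < fine (g z) + theta / 2 by rewrite ltrDl.
    have lt2 : fine (g z) - theta / 2 < fine (g z) by rewrite gtrBl.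
    have n1 := @cvgr_lt R _ _ (nbhs_filter z) _ _ cz _ lt1.
    have n2 := @cvgr_gt R _ _ (nbhs_filter z) _ _ cz _ lt2.
    by apply: (@filterS2 _ (nbhs z) (nbhs_filter z) _ _ _ _ n1 n2) => y /= -> ->.
  have /nbhs_ballP[e /= e0 eP] := near_z.
  exists (ball z (e / 2), ball (0 : 'rV[R]_N.+1) (e / 2)) => /=.
    by split; apply: nbhsx_ballx; rewrite divr_gt0.
  move=> [y u] /= [zy zu].
  have /andP[h1 _] : fine (g z) - theta / 2 < fine (g y) < fine (g z) + theta / 2.
    by apply: eP; apply: le_ball zy; rewrite ler_pdivrMr// ler_peMr ?ler1n// ltW.
  have /andP[_ h2] : fine (g z) - theta / 2 < fine (g (y + u)) < fine (g z) + theta / 2.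
    apply: eP; move: zy zu; rewrite -!ball_normE /ball_ /= sub0r normrN => zy zu.
    rewrite opprD addrA [e]splitr; apply: le_lt_trans (ler_normB _ _) _.
    exact: ltrD.
  by rewrite /P; lra.
have /nbhs_ballP[d /= d0 dK] := ncK _ _ P (nbhs_filter _) K1.
exists d => // z u Mz zrho ud; apply: (dK u).
  by rewrite -ball_normE /ball_ /= sub0r normrN.
by split => //=; apply/negP; rewrite -leNgt.
Qed.

Lemma norm_le_coord (u : 'rV[R]_N.+1) (d : R) :
  0 <= d -> (forall i, `|u ord0 i| <= d) -> `|u| <= d.
Proof.
move=> d0 ud; rewrite [leLHS]/Num.norm/= mx_normrE; apply: bigmax_le => // -[i j] _ /=.
by rewrite ord1.
Qed.

(* The box is thin: for z in the half-space 0 <= z_0 with |z| <= M, the gain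
   u_0 ^ 2 > d ^ 2 / 4 in the first coordinate of z + u outweighs the loss in
   the others, so that z + u is farther from the origin than z. *)
Lemma enorm_shift (z u : 'rV[R]_N.+1) (M d e : R) :
  0 <= M -> 0 <= d -> 0 <= e -> 8 * (N.+1%:R * M) * e <= d ^+ 2 ->
  0 <= z ord0 ord0 -> `|z| <= M -> d / 2 <= u ord0 ord0 ->
  (forall i, i != ord0 -> `|u ord0 i| <= e) -> enorm z <= enorm (z + u).
Proof.
move=> M0 d0 e0 ed z0 zM u0 ue; rewrite /enorm; apply: ler_wsqrtr.
rewrite !big_ord_recl /=.
have h0 : z ord0 ord0 ^+ 2 + d ^+ 2 / 4 <= (z + u) ord0 ord0 ^+ 2.
  rewrite mxE; nra.
have hS (i : 'I_N) : z ord0 (lift ord0 i) ^+ 2 - 2 * M * e <= (z + u) ord0 (lift ord0 i) ^+ 2.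
  have h1 := le_trans (coord_le_norm z (lift ord0 i)) zM.
  have h2 := ue (lift ord0 i) isT.
  have h3 : `|z ord0 (lift ord0 i) * u ord0 (lift ord0 i)| <= M * e by rewrite normrM ler_pM.
  have := ler_normlP _ _ h3 => -[h4 _].
  rewrite mxE; have := sqr_ge0 (u ord0 (lift ord0 i)); nra.
have : \sum_(i < N) (z ord0 (lift ord0 i) ^+ 2 - 2 * M * e) <=
    \sum_(i < N) (z + u) ord0 (lift ord0 i) ^+ 2 by apply: ler_sum => i _.
rewrite sumrB sumr_const card_ord -[_ *+ N]mulr_natr => h.
have : 2 * M * e * N%:R <= d ^+ 2 / 4.
  have : 0 <= M * e by exact: mulr_ge0.
  move: ed; rewrite -natr1; nra.
move: h h0; nra.
Qed.

(** For |z| <= M the shift increases the Euclidean norm and [g] decreases there; for |z| > M uniform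
    continuity bounds the change, and |u| < M keeps z + u away from 0. *)
Lemma outward_box (rho theta : R) : 0 < theta ->
  exists a b : 'I_N.+1 -> R, [/\ forall i, a i < b i,
    forall u : 'rV[R]_N.+1, (forall i, a i < u ord0 i < b i) -> `|u| <= 1 &
    forall u z : 'rV[R]_N.+1, (forall i, a i < u ord0 i < b i) ->
      z != 0 -> `|z| <= rho -> 0 <= z ord0 ord0 ->
      z + u != 0 /\ fine (g (z + u)) <= fine (g z) + theta].
Proof.
move=> theta0; have [rb rb0 decr] := g_decr.
pose n : R := N.+1%:R; have n1 : 1 <= n by rewrite ler1n.
have n0 : 0 < n by rewrite ltr0n.
(* This keeps enorm (z + u) <= n (|z| + |u|) <= 2 n M below [rb] when |z| and |u| are at most M. *)
have [M ME] : exists M, M = rb / (4 * n) by eexists.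
have M0 : 0 < M by rewrite ME divr_gt0// mulr_gt0.
have [d0 d00 unif] := uniform_shift rho M0 theta0.
have [d [d_gt0 dd0 dM d1]] : exists d : R, [/\ 0 < d, d < d0, d < M & d < 1].
  exists (Num.min (Num.min d0 M) 1 / 2).
  have m0 : 0 < Num.min (Num.min d0 M) 1 by rewrite !lt_min d00 M0 ltr01.
  have h : Num.min (Num.min d0 M) 1 / 2 < Num.min (Num.min d0 M) 1 by lra.
  by split; [exact: divr_gt0| | |]; apply: lt_le_trans h _; rewrite !ge_min lexx ?orbT.
(* [e] is the half-width of the box in all coordinates but the first, thin enough for
   [enorm_shift]. *)
have [e [e0 ed eD]] : exists e : R, [/\ 0 < e, e <= d & 8 * (n * M) * e <= d ^+ 2].
  have nM : 0 < 8 * (n * M) by rewrite !mulr_gt0.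
  exists (Num.min d (d ^+ 2 / (8 * (n * M)))); split.
  - by rewrite lt_min d_gt0 divr_gt0// exprn_gt0.
  - by rewrite ge_min lexx.
  - by rewrite mulrC -ler_pdivlMr// ge_min lexx orbT.
pose a (i : 'I_N.+1) := if i == ord0 then d / 2 else - e.
pose b (i : 'I_N.+1) := if i == ord0 then d else e.
have u_d (u : 'rV[R]_N.+1) : (forall i, a i < u ord0 i < b i) -> `|u| <= d.
  move=> ub; apply: norm_le_coord; first exact: ltW.
  move=> i; have := ub i; rewrite /a /b ler_norml; case: ifP => _ /andP[h1 h2].
    by rewrite (ltW h2) andbT; lra.
  by apply/andP; split; lra.
exists a, b; split.
- by move=> i; rewrite /a /b; case: ifP => _; lra.
- by move=> u /u_d h; apply: le_trans h (ltW d1).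
move=> u z ub z0 zrho zpos; have ud := u_d u ub.
have [zM|Mz] := leP `|z| M; last first.
  split; last by apply: unif => //; [exact: ltW|exact: le_lt_trans dd0].
  apply/negP; rewrite addr_eq0 => /eqP zu; move: Mz; rewrite zu normrN ltNge.
  by rewrite (le_trans ud)// ltW.
have zu : enorm z <= enorm (z + u).
  apply: (@enorm_shift _ _ M d e); rewrite ?(ltW M0) ?(ltW d_gt0) ?(ltW e0)//.
  - by have := ub ord0; rewrite /a eqxx => /andP[/ltW].
  - move=> i i0; have := ub i; rewrite /a /b (negPf i0) => /andP[h1 h2].
    by rewrite ler_norml !ltW.
have zp := enorm_gt0 z0.
have zu0 : z + u != 0.
  apply/negP => /eqP h; have := lt_le_trans zp zu; rewrite h /enorm.
  by rewrite big1 ?sqrtr0 ?ltxx// => i _; rewrite mxE expr0n.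
split=> //.
have : (g (z + u) <= g z)%E.
  apply: decr => //; apply: le_lt_trans (enorm_le _) _.
  apply: (@le_lt_trans _ _ (n * (2 * M))).
    by rewrite ler_wpM2l ?(ltW n0)// (le_trans (ler_normD _ _))//; lra.
  rewrite ME (_ : n * (2 * (rb / (4 * n))) = rb / 2); last by field; rewrite gt_eqF.
  by lra.
rewrite -[g z]fineK ?g_fin// -[g (z + u)]fineK ?g_fin// lee_fin => h.
by apply: le_trans h _; rewrite lerDl ltW.
Qed.

End outward_shift.

(** * Adding points to a configuration *)

Lemma exists_le_mean (R : realType) (T : eqType) (s : seq T) (F : T -> R) :
  (0 < size s)%N -> exists2 x, x \in s & F x * (size s)%:R <= \sum_(x <- s) F x.
Proof.
move=> s0; apply: contrapT => /forall2NP H.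
have : \sum_(x <- s) (\sum_(x <- s) F x) / (size s)%:R < \sum_(x <- s) F x.
  rewrite big_seq_cond [ltRHS]big_seq_cond; apply: ltr_sum => [|x /andP[xs _]].
    by case: s s0 {H} => // x s _; apply/hasP; exists x; rewrite ?mem_head.
  by have [//|/negP] := H x; rewrite -ltNge ltr_pdivrMr ?ltr0n.
by rewrite sumr_const_seq -[_ *+ size s]mulr_natr divfK ?ltxx// pnatr_eq0 -lt0n.
Qed.

Lemma split_extreme (R : realType) (N T : nat) (Y : seq 'rV[R]_N.+1) :
  (T <= size Y)%N -> exists Y1 Y2, [/\ perm_eq Y (Y1 ++ Y2), size Y1 = T &
    forall x y, x \in Y1 -> y \in Y2 -> y ord0 ord0 <= x ord0 ord0].
Proof.
move=> TY; pose r (x y : 'rV[R]_N.+1) := y ord0 ord0 <= x ord0 ord0.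
have r_tot : total r by move=> x y; exact: le_total.
have r_trans : transitive r by move=> y x z xy yz; exact: le_trans yz xy.
have := sort_sorted r_tot Y; rewrite (sorted_pairwise r_trans).
rewrite -(cat_take_drop T (sort r Y)) pairwise_cat => /andP[/allrelP rel _].
exists (take T (sort r Y)), (drop T (sort r Y)); split.
- by rewrite cat_take_drop perm_sym perm_sort.
- by rewrite size_takel// size_sort.
- by move=> x y; exact: rel.
Qed.

Section replenish.
Context {R : realType} {N : nat}.
Variables (g : 'rV[R]_N.+1 -> \bar R) (c B : R).
Hypotheses (c_ge0 : 0 <= c) (B_gt0 : 0 < B).
Hypothesis g_fin : forall x, x != 0 -> g x \is a fin_num.
Hypothesis gN : forall x, g (- x) = g x.
Hypothesis g_ge : forall x, ((- c)%:E <= g x)%E.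
Hypothesis g_lsc : lower_semicontinuous g.
Hypothesis g_L1loc : locally_integrable_rV g.
Hypothesis g_cont : {within [set~ (0 : 'rV[R]_N.+1)], continuous g}.
Hypothesis g_decr : exists2 r : R, 0 < r & forall x y : 'rV[R]_N.+1,
  0 < enorm x -> enorm x <= enorm y -> enorm y < r -> (g y <= g x)%E.
Local Notation f := (fine \o g).
Hypothesis pairsum_lb : forall eps : R, 0 < eps -> exists C : R,
  forall s, pairwise (fin_rel g) s ->
    - (B + eps) * (size s)%:R ^+ 2 - C <= pairsum f s.

(** Where [g] is [+oo], [fine] returns 0, which is still at least [- c]. *)
Lemma fine_ge x : - c <= f x.
Proof. by have := g_ge x; rewrite /=; case: (g x) => [r| |]//=; rewrite oppr_le0. Qed.

Lemma fineN x : f (- x) = f x. Proof. by rewrite /= gN. Qed.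

(** Arithmetic for [singular_add_one]: [m], [T] and [q] are the sizes of [Y], [Y1] and [W]. The main
    term is - 2 B m T. Four errors of at most (B / 4) m T each are spent on the shift, the terms in
    T ^ 2, those in eps m ^ 2, and the new points. *)
Lemma extreme_sum_bound (m T q C C0 eps beta : R) :
  0 < m -> 0 <= C -> 0 < beta -> beta <= B / (8 * (B + c + C)) ->
  beta * m <= T -> T <= 2 * beta * m -> 0 <= q -> q <= 12 * eps / B * m ->
  0 < eps -> eps <= B * beta / 16 -> eps <= B ^+ 2 / (48 * C + 48) -> C0 <= eps * m ^+ 2 ->
  - (B - 2 * eps) * m ^+ 2 + c * T ^+ 2 / 2 + (B + eps) * (m - T) ^+ 2 + C0 +
    B / 4 * T * m + C * (T * (T + q)) <= - B * m * T.
Proof.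
move: (c_ge0) (B_gt0) => c0 B0 m0 C0' b0 bB bT Tb q0 qe e0 e1 e2 C0e.
have BcC : 0 < 8 * (B + c + C) by rewrite mulr_gt0// !ltr_wpDr.
have {}bB : beta * (8 * (B + c + C)) <= B by rewrite -ler_pdivlMr.
have T0 : 0 < T by apply: lt_le_trans bT; rewrite mulr_gt0.
have Tm : T <= m.
  apply: le_trans Tb _; rewrite ler_piMl ?(ltW m0)//.
  rewrite -(ler_pM2r B_gt0).
  have : 0 <= beta * (c + C) by rewrite mulr_ge0 ?addr_ge0// ltW.
  have : 0 <= beta * B by rewrite mulr_ge0// ltW.
  lra.
have hT2 : (B + c / 2 + C) * T ^+ 2 <= B / 4 * (m * T).
  have h : (B + c / 2 + C) * (T * T) <= (B + c + C) * (T * (2 * beta * m)).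
    apply: ler_pM; [by lra|by rewrite mulr_ge0// ltW|by lra|].
    by rewrite ler_wpM2l// ltW.
  rewrite expr2; apply: le_trans h _.
  have := ler_wpM2r (ltW (mulr_gt0 m0 T0)) bB; lra.
have heps : 4 * eps * m ^+ 2 <= B / 4 * (m * T).
  have h : eps * 16 <= B * beta by lra.
  have h1 : eps * 16 * (m * m) <= B * beta * (m * m) by rewrite ler_wpM2r// mulr_ge0// ltW.
  have h2 : B * m * (beta * m) <= B * m * T by rewrite ler_wpM2l// mulr_ge0// ltW.
  rewrite expr2; lra.
have hq : C * (T * q) <= B / 4 * (m * T).
  have h : C * q <= B / 4 * m.
    apply: le_trans (ler_wpM2l C0' qe) _.
    have C48 : 0 < 48 * C + 48 by lra.
    have {}e2 : eps * (48 * C + 48) <= B ^+ 2 by rewrite -ler_pdivlMr.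
    rewrite mulrA ler_wpM2r ?(ltW m0)//.
    rewrite mulrA ler_pdivrMr//; nra.
  rewrite (_ : C * (T * q) = C * q * T); last by ring.
  by rewrite (_ : B / 4 * (m * T) = B / 4 * m * T) ?ler_wpM2r ?(ltW T0)//; ring.
have hmT : eps * (m - T) ^+ 2 <= eps * m ^+ 2.
  rewrite ler_wpM2l ?(ltW e0)// ler_sqr ?nnegrE ?(ltW m0) ?subr_ge0//; lra.
nra.
Qed.

(* The new point is x + u, with x among the T extreme points Y1 of Y in the first
   coordinate and u in the box of outward_box. *)
Lemma singular_add_one (rho : R) : g 0 = +oo%E -> exists2 eps0 : R, 0 < eps0 &
  forall eps : R, 0 < eps -> eps <= eps0 -> exists m0 : nat, forall Y W : seq 'rV[R]_N.+1,
  (m0 <= size Y)%N -> pairwise (fin_rel g) Y -> (forall x, x \in Y ++ W -> `|x| <= rho + 1) ->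
  (forall x, x \in Y -> `|x| <= rho) ->
  pairsum f Y <= - (B - 2 * eps) * (size Y)%:R ^+ 2 ->
  (size W)%:R <= 12 * eps / B * (size Y)%:R ->
  exists w, [/\ `|w| <= rho + 1, all (fin_rel g w) (Y ++ W) &
    \sum_(y <- Y ++ W) f (w - y) <= - B * (size Y)%:R].
Proof.
move: (c_ge0) (B_gt0) => c0 B0 g0.
have B4 : 0 < B / 4 by rewrite divr_gt0.
have [a [b [ab box1 boxP]]] := outward_box g_fin g_cont g_decr (2 * rho) B4.
have [C C_ge0 CP] := average_shift_bound c_ge0 g_ge g_lsc g_L1loc (2 * rho + 1) ab box1.
have BcC : 0 < 8 * (B + c + C) by rewrite mulr_gt0// !ltr_wpDr.
have [beta betaE] : exists beta, beta = B / (8 * (B + c + C)) by eexists.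
have beta0 : 0 < beta by rewrite betaE divr_gt0.
have C48 : 0 < 48 * C + 48 by rewrite ltr_wpDl// mulr_ge0.
exists (Num.min (B * beta / 16) (B ^+ 2 / (48 * C + 48))).
  by rewrite lt_min !divr_gt0 ?mulr_gt0 ?exprn_gt0.
move=> eps eps0; rewrite le_min => /andP[eps1 eps2].
have [C0 lb] := pairsum_lb eps0.
have [m0 m0P] := exists_nat_ge (`|C0| / eps + 1 / beta + 1).
exists m0 => Y W mY admY YW Yrho PY Wq.
(* Since [g] is infinite exactly at 0, admissible lists are the duplicate-free ones. *)
have admN x y : fin_rel g x y = (x != y).
  rewrite /fin_rel; case: eqVneq => [->|xy]; first by rewrite subrr g0.
  by rewrite g_fin// subr_eq0.
set m : R := (size Y)%:R in PY Wq *.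
have mP : `|C0| / eps + 1 / beta + 1 <= m by apply: le_trans m0P _; rewrite ler_nat.
have i1 : 0 <= `|C0| / eps by rewrite divr_ge0// ltW.
have i2 : 0 <= 1 / beta by rewrite divr_ge0// ltW.
have m1 : 1 <= m by lra.
have m_gt0 : 0 < m by lra.
have hC0 : C0 <= eps * m ^+ 2.
  apply: le_trans (ler_norm C0) _.
  have : `|C0| / eps <= m by lra.
  have : 0 <= eps * m * (m - 1) by rewrite !mulr_ge0 ?subr_ge0// ltW.
  rewrite ler_pdivrMr// expr2; lra.
have bm1 : 1 <= beta * m by rewrite mulrC -ler_pdivrMr//; lra.
(* The successor ensures T >= beta m, and beta m >= 1 ensures T <= 2 beta m. *)
pose T := (Num.trunc (beta * m)).+1.
have bmT : beta * m <= T%:R /\ T%:R <= 2 * beta * m.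
  have /truncn_itv /andP[h1 h2] : 0 <= beta * m by lra.
  split; first exact: ltW.
  rewrite /T -natr1; lra.
have b8 : beta <= 1 / 8.
  rewrite betaE ler_pdivrMr//; lra.
have TY : (T <= size Y)%N.
  by rewrite -(ler_nat R); apply: le_trans bmT.2 _; rewrite -/m; nra.
have [Y1 [Y2 [YE sY1 Y12]]] := split_extreme TY.
have sYE : m = T%:R + (size Y2)%:R by rewrite /m (perm_size YE) size_cat natrD sY1.
have Ysub x : x \in Y1 ++ Y2 -> x \in Y by rewrite (perm_mem YE).
(* These are the differences that are bounded only on average over [u]: those with the new points
   and those inside [Y1], including x - x = 0, which contributes g u. *)
pose zs := [seq x - y | x <- Y1, y <- Y1 ++ W].
have [u [ubox ufin uC]] : exists u : 'rV[R]_N.+1, [/\ forall i, a i < u ord0 i < b i,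
    (forall z, z \in zs -> g (z + u) \is a fin_num) &
    (\sum_(z <- zs) (fine (g (z + u)) + c) <= C * (size zs)%:R)].
  apply: CP => _ /allpairsP[[x y] /= [xY1 yYW ->]].
  apply: le_trans (ler_normB _ _) _.
  have hx : `|x| <= rho by apply/Yrho/Ysub; rewrite mem_cat xY1.
  have hy : `|y| <= rho + 1.
    apply: YW; move: yYW; rewrite !mem_cat => /orP[yY1|->]; last by rewrite orbT.
    by rewrite (Ysub y)// mem_cat yY1.
  lra.
have wE x y : x + u - y = x - y + u by rewrite addrAC.
have admY12 : pairwise (fin_rel g) (Y1 ++ Y2).
  have uniqE s : pairwise (fin_rel g) s = uniq s.
    by rewrite uniq_pairwise; exact: (eq_pairwise admN).
  by rewrite uniqE -(perm_uniq YE) -uniqE.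
have xy_neq x y : x \in Y1 -> y \in Y2 -> x - y != 0.
  move=> x1 y2; rewrite subr_eq0 -admN.
  by move: admY12; rewrite pairwise_cat => /andP[/allrelP + _]; exact.
have shiftP x y : x \in Y1 -> y \in Y2 ->
    x - y + u != 0 /\ f (x - y + u) <= f (x - y) + B / 4.
  move=> x1 y2; apply: boxP => //; first exact: xy_neq.
    apply: le_trans (ler_normB _ _) _.
    have hx : `|x| <= rho by apply/Yrho/Ysub; rewrite mem_cat x1.
    have hy : `|y| <= rho by apply/Yrho/Ysub; rewrite mem_cat y2 orbT.
    lra.
  by rewrite !mxE subr_ge0; exact: Y12.
have Y1_0 : (0 < size Y1)%N by rewrite sY1.
have [x xY1] := exists_le_mean (fun x => \sum_(y <- Y ++ W) f (x + u - y)) Y1_0.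
rewrite sY1 => Sx; exists (x + u); split.
- apply: le_trans (ler_normD _ _) _; apply: lerD; last exact: box1.
  by apply/Yrho/Ysub; rewrite mem_cat xY1.
- apply/allP => y; rewrite mem_cat (perm_mem YE) mem_cat /fin_rel wE => yYW.
  have [y2|y2] := boolP (y \in Y2); first by apply: g_fin; exact: (shiftP x y xY1 y2).1.
  apply: ufin; apply/allpairsP; exists (x, y); split=> //=; rewrite mem_cat.
  by move: yYW; rewrite (negPf y2) orbF.
have sum_split : \sum_(x <- Y1) \sum_(y <- Y ++ W) f (x + u - y) =
    \sum_(x <- Y1) \sum_(y <- Y2) f (x - y + u) + \sum_(z <- zs) f (z + u).
  rewrite big_allpairs_dep -big_split; apply: eq_bigr => x' _ /=.
  rewrite big_cat (perm_big _ YE) !big_cat /= addrAC [RHS]addrC; congr (_ + _ + _);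
  by apply: eq_bigr => y _; rewrite wE.
have le1 : \sum_(x <- Y1) \sum_(y <- Y2) f (x - y + u) <=
    crosssum f Y1 Y2 + B / 4 * T%:R * (size Y2)%:R.
  rewrite -mulrA [T%:R * _]mulrC mulrA -sY1 [leRHS](_ : _ = \sum_(x <- Y1) \sum_(y <- Y2) (f (x - y) + B / 4)).
    rewrite big_seq [leRHS]big_seq; apply: ler_sum => x' x1.
    rewrite big_seq [leRHS]big_seq; apply: ler_sum => y y2.
    exact: (shiftP x' y x1 y2).2.
  rewrite /crosssum [RHS](eq_bigr (fun x' => \sum_(y <- Y2) f (x' - y) + B / 4 * (size Y2)%:R)).
    by rewrite big_split /= sumr_const_seq mulr_natr.
  by move=> x' _; rewrite big_split /= sumr_const_seq mulr_natr.
have le2 : \sum_(z <- zs) f (z + u) <= C * (T%:R * (T%:R + (size W)%:R)).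
  rewrite -natrD -natrM -sY1 -size_cat -(size_allpairs (fun x y => x - y)).
  by apply: le_trans uC; apply: ler_sum => z _; rewrite lerDl.
(* The interaction of [Y1] with [Y2] is what remains of the energy of [Y] after subtracting both
   self-energies; lower bounds on these make it very negative. *)
have PE : pairsum f Y = pairsum f Y1 + crosssum f Y1 Y2 + pairsum f Y2.
  by rewrite (pairsum_perm fineN YE) pairsum_cat.
have nc0 : - c <= 0 by rewrite oppr_le0.
have P1 := ler_pairsum_cst Y1 nc0 fine_ge.
have P2 : - (B + eps) * (size Y2)%:R ^+ 2 - C0 <= pairsum f Y2.
  by apply: lb; move: admY12; rewrite pairwise_cat => /and3P[].
have tot := @extreme_sum_bound m T%:R (size W)%:R C C0 eps beta m_gt0 C_ge0 beta0.
rewrite -betaE in tot.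
have {}tot := tot (lexx _) bmT.1 bmT.2 (ler0n _ _) Wq eps0 eps1 eps2 hC0.
have T0 : 0 < T%:R :> R by rewrite ltr0n.
rewrite -(ler_pM2r T0); apply: le_trans Sx _; rewrite sum_split.
apply: le_trans (lerD le1 le2) _; apply: le_trans tot.
have : B / 4 * T%:R * (size Y2)%:R <= B / 4 * T%:R * m.
  apply: ler_wpM2l; first by rewrite mulr_ge0// ltW.
  by rewrite [leRHS]sYE lerDr.
have sY2 : (size Y2)%:R = m - T%:R by rewrite [X in X - _]sYE addrAC subrr add0r.
rewrite sY2 in P2 *; rewrite sY1 in P1; move: P1 P2 PE PY; lra.
Qed.

(** Points are added one at a time while [Y] stays fixed: the bound on k keeps [W] small enough for
    the next use of [singular_add_one], whose bound already includes the interaction with [W]. *)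
Lemma singular_replenish (rho : R) : g 0 = +oo%E -> exists2 eps0 : R, 0 < eps0 &
  forall eps : R, 0 < eps -> eps <= eps0 -> exists m0 : nat, forall Y : seq 'rV[R]_N.+1,
  (m0 <= size Y)%N -> pairwise (fin_rel g) Y -> (forall x, x \in Y -> `|x| <= rho) ->
  pairsum f Y <= - (B - 2 * eps) * (size Y)%:R ^+ 2 ->
  forall k : nat, k%:R <= 12 * eps / B * (size Y)%:R ->
  exists W, [/\ size W = k, forall x, x \in W -> `|x| <= rho + 1,
    pairwise (fin_rel g) (W ++ Y) &
    pairsum f (W ++ Y) <= pairsum f Y - k%:R * B * (size Y)%:R].
Proof.
move=> g0; have [eps0 eps0_gt0 H] := singular_add_one rho g0.
exists eps0 => // eps eps_gt0 /H[//|m0 {}H]; exists m0 => Y mY admY Yrho PY.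
elim=> [_|k IHk kq]; first by exists [::]; split=> //=; rewrite !mul0r subr0.
have [|W [sW Wrho admWY PWY]] := IHk.
  by apply: le_trans kq; rewrite ler_nat.
have YWrho x : x \in Y ++ W -> `|x| <= rho + 1.
  rewrite mem_cat => /orP[/Yrho|/Wrho//] h; apply: le_trans h _.
  by rewrite lerDl.
have [|w [wrho admw Pw]] := H Y W mY admY YWrho Yrho PY.
  by rewrite sW; apply: le_trans kq; rewrite ler_nat.
exists (w :: W); split=> /=.
- by rewrite sW.
- by move=> x; rewrite inE => /predU1P[->//|/Wrho].
- by rewrite admWY andbT all_cat andbC -all_cat.
- have -> : \sum_(y <- W ++ Y) f (w - y) = \sum_(y <- Y ++ W) f (w - y).
    by rewrite !big_cat /= addrC.
  rewrite -natr1; move: (lerD PWY Pw); lra.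
Qed.

(* It suffices to repeat k times a point of Y with a minimal potential. *)
Lemma regular_replenish (rho : R) : g 0 \is a fin_num -> exists2 eps0 : R, 0 < eps0 &
  forall eps : R, 0 < eps -> eps <= eps0 -> exists m0 : nat, forall Y : seq 'rV[R]_N.+1,
  (m0 <= size Y)%N -> pairwise (fin_rel g) Y -> (forall x, x \in Y -> `|x| <= rho) ->
  pairsum f Y <= - (B - 2 * eps) * (size Y)%:R ^+ 2 ->
  forall k : nat, k%:R <= 12 * eps / B * (size Y)%:R ->
  exists W, [/\ size W = k, forall x, x \in W -> `|x| <= rho + 1,
    pairwise (fin_rel g) (W ++ Y) &
    pairsum f (W ++ Y) <= pairsum f Y - k%:R * B * (size Y)%:R].
Proof.
move: (B_gt0) => B0 g0; pose F := `|f 0|.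
have F0 : 0 <= F by exact: normr_ge0.
have D0 : 0 < 6 * F / B + 4 by rewrite ltr_wpDl// divr_ge0 ?mulr_ge0// ltW.
(* With k <= (12 eps / B) m, the self-interaction of the copies and the error 4 eps m together cost
   at most (B / 2) m per copy. The remaining term [F] costs another (B / 2) m once m is large, out
   of the available 2 B m. *)
exists (B / 2 / (6 * F / B + 4)); first by rewrite !divr_gt0.
move=> eps eps_gt0; rewrite ler_pdivlMr// => epsD.
have [m0 m0P] := exists_nat_ge (F / (B / 2) + 1).
exists m0 => Y mY _ Yrho PY k kq.
have fin x y : fin_rel g x y.
  rewrite /fin_rel; have [->|] := eqVneq (x - y) 0; first exact: g0.
  exact: g_fin.
have mP : F / (B / 2) + 1 <= (size Y)%:R by apply: le_trans m0P _; rewrite ler_nat.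
have FB : 0 <= F / (B / 2) by rewrite divr_ge0// divr_ge0// ltW.
have m_gt0 : 0 < (size Y)%:R :> R by lra.
have hF : F <= B / 2 * (size Y)%:R.
  have : F / (B / 2) <= (size Y)%:R by lra.
  by rewrite ler_pdivrMr ?divr_gt0// mulrC.
have sY : (0 < size Y)%N by rewrite -(ltr0n R).
have [x xY] := exists_le_mean (fun x => \sum_(y <- Y) f (x - y)) sY.
rewrite -/(crosssum f Y Y) crosssum_diag; last exact: fineN.
rewrite -[f 0 *+ size Y]mulr_natr -[pairsum f Y *+ 2]mulr_natr => Sx; cbv beta in Sx.
set m : R := (size Y)%:R in m_gt0 hF mP PY kq Sx *.
set S := \sum_(y <- Y) f (x - y) in Sx.
have f0F : f 0 <= F by exact: ler_norm.
have S_le : S <= - 2 * (B - 2 * eps) * m + F.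
  rewrite -(ler_pM2r m_gt0). apply: le_trans Sx _.
  have : f 0 * m <= F * m by rewrite ler_pM2r.
  by rewrite expr2 in PY; lra.
exists (nseq k x); split.
- by rewrite size_nseq.
- by move=> y /nseqP[-> _]; apply: le_trans (Yrho _ xY) _; rewrite lerDl.
- elim: (nseq k x ++ Y) => //= y s ->; rewrite andbT; apply/allP => z _; exact: fin.
have [k0|k0] := posnP k; first by rewrite k0 /= !mul0r subr0.
have k1 : 1 <= k%:R :> R by rewrite ler1n.
have -> : pairsum f (nseq k x ++ Y) = k%:R * (k%:R - 1) / 2 * f 0 + k%:R * S + pairsum f Y.
  rewrite pairsum_cat; congr (_ + _ + _).
    elim: k {kq k0 k1} => [|k IHk] /=; first by rewrite !mul0r.
    rewrite IHk -natr1 (eq_big_seq (fun=> f 0)) => [|y /nseqP[-> _]]; last by rewrite subrr.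
    by rewrite sumr_const_seq size_nseq -[f 0 *+ k]mulr_natr /=; field.
  rewrite /crosssum (eq_big_seq (fun=> S)) => [|y /nseqP[-> _]//].
  by rewrite sumr_const_seq size_nseq -[S *+ k]mulr_natr mulrC.
have kS : k%:R * S <= k%:R * (- 2 * (B - 2 * eps) * m + F) by rewrite ler_wpM2l.
have kk : 0 <= k%:R * (k%:R - 1) / 2 :> R by rewrite divr_ge0// mulr_ge0// subr_ge0.
have kf0 : k%:R * (k%:R - 1) / 2 * f 0 <= k%:R * (k%:R / 2 * F).
  apply: le_trans (ler_wpM2l kk f0F) _.
  have : 0 <= k%:R * F by exact: mulr_ge0.
  lra.
have kF : k%:R / 2 * F <= 6 * eps / B * m * F.
  rewrite ler_wpM2r//; move: kq; rewrite [12 * eps / B]mulrAC [6 * eps / B]mulrAC; lra.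
have eF : 6 * eps / B * m * F + 4 * eps * m <= B / 2 * m.
  rewrite (_ : 6 * eps / B * m * F + 4 * eps * m = eps * (6 * F / B + 4) * m).
    by rewrite ler_pM2r.
  by ring.
have kfin : k%:R * (k%:R / 2 * F + (- 2 * (B - 2 * eps) * m + F)) <= k%:R * (- B * m).
  rewrite ler_wpM2l//; lra.
move: kfin kf0 kS; rewrite mulrDr; lra.
Qed.

Lemma replenish (rho : R) : exists2 eps0 : R, 0 < eps0 &
  forall eps : R, 0 < eps -> eps <= eps0 -> exists m0 : nat, forall Y : seq 'rV[R]_N.+1,
  (m0 <= size Y)%N -> pairwise (fin_rel g) Y -> (forall x, x \in Y -> `|x| <= rho) ->
  pairsum f Y <= - (B - 2 * eps) * (size Y)%:R ^+ 2 ->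
  forall k : nat, k%:R <= 12 * eps / B * (size Y)%:R ->
  exists W, [/\ size W = k, forall x, x \in W -> `|x| <= rho + 1,
    pairwise (fin_rel g) (W ++ Y) &
    pairsum f (W ++ Y) <= pairsum f Y - k%:R * B * (size Y)%:R].
Proof.
have := g_ge 0; have := @singular_replenish rho; have := @regular_replenish rho.
by case: (g 0) => [r| |] reg sing // _; [exact: reg|exact: sing].
Qed.

End replenish.

(** * Confinement *)

Section confinement.
Context {R : realType} {N : nat}.
Variables (g : 'rV[R]_N.+1 -> \bar R) (c : R).
Hypotheses (c_gt0 : 0 < c).
Hypothesis g_fin : forall x, x != 0 -> g x \is a fin_num.
Hypothesis gN : forall x, g (- x) = g x.
Hypothesis g_ge : forall x, ((- c)%:E <= g x)%E.
Hypothesis g_lsc : lower_semicontinuous g.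
Hypothesis g_L1loc : locally_integrable_rV g.
Hypothesis g_liminf : (0 <= limf_einf g at_infinity)%E.
Hypothesis g_cont : {within [set~ (0 : 'rV[R]_N.+1)], continuous g}.
Hypothesis g_decr : exists2 r : R, 0 < r & forall x y : 'rV[R]_N.+1,
  0 < enorm x -> enorm x <= enorm y -> enorm y < r -> (g y <= g x)%E.
Local Notation f := (fine \o g).

Lemma norm_le_enorm (x : 'rV[R]_N.+1) : `|x| <= enorm x.
Proof.
apply: norm_le_coord => [|i]; first exact: sqrtr_ge0.
rewrite -sqrtr_sqr; apply: ler_wsqrtr; rewrite (bigD1 i)//= lerDl.
by apply: sumr_ge0 => j _; exact: sqr_ge0.
Qed.

Lemma fine_far (eta : R) : 0 < eta ->
  exists2 r : R, 0 < r & forall x, r < `|x| -> - eta <= f x.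
Proof.
move=> eta0; have : ((- eta)%:E < limf_einf g at_infinity)%E.
  by apply: lt_le_trans g_liminf; rewrite lte_fin oppr_lt0.
rewrite limf_einfE => /ereal_sup_gt[_ [V [M MV] <-] gV].
exists (Num.max M 1); first by rewrite lt_max ltr01 orbT.
move=> x; rewrite gt_max => /andP[Mx _].
have Vx : V x by apply: MV; exact: lt_le_trans Mx (norm_le_enorm x).
have : ((- eta)%:E < g x)%E.
  by apply: lt_le_trans gV _; apply: ereal_inf_lbound; exists x.
(* If [g x] is [+oo], then [f x] is 0 by default and the bound still holds. *)
rewrite /=; case: (g x) => [r| |]//=; first by rewrite lte_fin => /ltW.
by rewrite oppr_le0 ltW.
Qed.

(** Discarding [J] costs at most (B / 8) |J| n, while putting |J| points back near the core gains B
    |J| |I| with |I| >= n / 2. The threshold [L] is attained by some configuration, and [rho] does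
    not depend on [n]. *)
Lemma confinement (mu : probability 'rV[R]_N.+1 R) : (energy g mu < 0)%E ->
  exists (rho : R) (n0 : nat), forall n, (n0 <= n)%N -> exists L : R,
    (exists s, [/\ size s = n, pairwise (fin_rel g) s & pairsum f s <= L]) /\
    forall s, size s = n -> pairwise (fin_rel g) s -> pairsum f s <= L ->
    exists y, [/\ size y = n, forall x, x \in y -> `|x| <= rho,
      pairwise (fin_rel g) y & pairsum f y <= pairsum f s].
Proof.
move=> Emu; have c_ge0 : 0 <= c by exact: ltW.
have f_ge := fine_ge c_ge0 g_ge; have fN := fineN gN.
have [b0 b0_gt0 f_neg] := negative_configurations c_ge0 g_ge g_lsc Emu.
have [B [B_gt0 lb ub]] := ground_constant c_ge0 b0_gt0 fN f_ge f_neg.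
have [rho [eps1 [eps1_gt0 core]]] := core_decomposition c_gt0 B_gt0 fN f_ge fine_far lb.
have [eps0 eps0_gt0 repl] := replenish c_ge0 B_gt0 g_fin gN g_ge g_lsc g_L1loc g_cont g_decr lb rho.
(* The bound B / 12 turns |J| <= (6 eps / B) n into |J| <= n / 2. *)
have [eps [eps_gt0 le1 le0 leB]] : exists eps : R, [/\ 0 < eps, eps <= eps1, eps <= eps0 & eps <= B / 12].
  exists (Num.min (Num.min eps1 eps0) (B / 12)).
  by rewrite !lt_min !ge_min eps1_gt0 eps0_gt0 !lexx ?orbT divr_gt0.
have [n0 {}core] := core _ eps_gt0 le1; have [m0 {}repl] := repl _ eps_gt0 le0.
have [n1 {}ub] := ub _ eps_gt0.
exists (rho + 1), (maxn (maxn n0 (2 * m0)) (maxn n1 1)) => n.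
rewrite !geq_max => /andP[/andP[n0n m0n] /andP[n1n npos]].
have n_gt0 : 0 < n%:R :> R by rewrite ltr0n.
exists (- (B - eps) * n%:R ^+ 2); split.
  by have [s [sn adms Ps]] := ub n n1n; exists s; split=> //; rewrite -sn.
move=> s sn adms Ps.
have [||p [I [J [sIJ admI Irho Jn PI]]]] := core s _ adms _; rewrite ?sn//.
rewrite sn in Jn PI.
have sI : (size I)%:R = n%:R - (size J)%:R :> R.
  by rewrite -sn (perm_size sIJ) size_cat natrD addrK.
have J0 := ler0n R (size J).
have {}Jn : (size J)%:R * B <= 6 * eps * n%:R.
  by rewrite -ler_pdivlMr// mulrAC.
have J2 : (size J)%:R <= n%:R / 2 :> R.
  rewrite -(ler_pM2r B_gt0); apply: le_trans Jn _.
  have := ler_wpM2r (ltW n_gt0) leB; lra.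
pose Y := [seq x - p | x <- I].
have sY : size Y = size I by rewrite size_map.
have PY : pairsum f Y = pairsum f I by exact: pairsum_map_subr.
have admY : pairwise (fin_rel g) Y.
  rewrite pairwise_map; apply: sub_pairwise admI => x y.
  by rewrite /fin_rel /= opprB addrA subrK.
have Yrho x : x \in Y -> `|x| <= rho by move=> /mapP[y yI ->]; exact: Irho.
have [|||W [sW Wrho admWY PWY]] := repl Y _ admY Yrho _ (size J) _.
- rewrite sY -(ler_nat R) sI.
  have : (2 * m0)%:R <= n%:R :> R by rewrite ler_nat.
  rewrite natrM; lra.
(* The cost (B / 8) |J| n is at most eps n ^ 2, so the core is nearly optimal with 2 eps in place of
   eps. *)
- rewrite PY sY; apply: le_trans PI _; apply: le_trans (lerD Ps (lexx _)) _.
  have h1 : B / 8 * (size J)%:R * n%:R <= eps * n%:R ^+ 2.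
    rewrite expr2; have := ler_wpM2r (ltW n_gt0) Jn; nra.
  have h2 : (size I)%:R ^+ 2 <= n%:R ^+ 2 :> R.
    by rewrite ler_sqr ?nnegrE// ?(ltW n_gt0)// sI; lra.
  have h3 : 0 <= B - 2 * eps by lra.
  have := ler_wpM2l h3 h2; lra.
(* From n <= 2 |I|, the factor 6 relative to n becomes 12 relative to the size of the core. *)
- rewrite sY sI mulrAC ler_pdivlMr//.
  have : eps * (size J)%:R <= eps * (n%:R / 2) by rewrite ler_pM2l.
  lra.
exists (W ++ Y); split=> //.
- by rewrite size_cat sW sY addnC -size_cat -(perm_size sIJ).
- move=> x; rewrite mem_cat => /orP[/Wrho//|/Yrho h].
  by apply: le_trans h _; rewrite lerDl.
- apply: le_trans PWY _; rewrite PY sY sI.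
  have : 0 <= (size J)%:R * B by rewrite mulr_ge0// ltW.
  nra.
Qed.

End confinement.

(** * Existence of minimizers *)

Section lower_semicontinuity.
Context {R : realType} {X : topologicalType}.
Implicit Types f : X -> \bar R.
Local Open Scope ereal_scope.

Lemma lower_semicontinuousD f1 f2 : (forall x, -oo < f1 x) -> (forall x, -oo < f2 x) ->
  lower_semicontinuous f1 -> lower_semicontinuous f2 ->
  lower_semicontinuous (fun x => f1 x + f2 x).
Proof.
move=> n1 n2 l1 l2 x a ax.
suff [a1 [a2 [/l1[V1 xV1 h1] /l2[V2 xV2 h2] aE]]] :
    exists a1 a2 : R, [/\ a1%:E < f1 x, a2%:E < f2 x & a = (a1 + a2)%R].
  exists (V1 `&` V2); first exact: filterI.
  by move=> y [/h1 ? /h2 ?]; rewrite aE EFinD lteD.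
move: (n1 x) (n2 x) ax; case: (f1 x) => [r1| |]//; case: (f2 x) => [r2| |]// _ _.
- rewrite -EFinD lte_fin => ar.
  exists (r1 - (r1 + r2 - a) / 2)%R, (r2 - (r1 + r2 - a) / 2)%R.
  by rewrite !lte_fin; split; lra.
- by exists (r1 - 1)%R, (a - (r1 - 1))%R; rewrite lte_fin ltry; split => //; lra.
- by exists (a - (r2 - 1))%R, (r2 - 1)%R; rewrite lte_fin ltry; split => //; lra.
- by exists a, 0%R; rewrite !ltry addr0.
Qed.

Lemma lower_semicontinuous_sum (I : Type) (s : seq I) (P : pred I) (F : I -> X -> \bar R) :
  (forall i x, -oo < F i x) -> (forall i, lower_semicontinuous (F i)) ->
  lower_semicontinuous (fun x => \sum_(i <- s | P i) F i x).
Proof.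
move=> nF lF; elim: s => [|i s IHs].
  move=> x a; rewrite big_nil => a0; exists setT; first exact: filterT.
  by move=> y _; rewrite big_nil.
have -> : (fun x => \sum_(j <- i :: s | P j) F j x) =
    (fun x => if P i then F i x + \sum_(j <- s | P j) F j x else \sum_(j <- s | P j) F j x).
  by apply/funext => x; rewrite big_cons.
case: (P i) => //.
by apply: lower_semicontinuousD => // x; exact: sume_gtNy.
Qed.

Lemma lower_semicontinuous_comp (Y : topologicalType) (h : X -> Y) (f : Y -> \bar R) :
  continuous h -> lower_semicontinuous f -> lower_semicontinuous (f \o h).
Proof.
move=> ch lf x a /lf[V xV Va]; exists (h @^-1` V); first exact: ch.
by move=> y; exact: Va.
Qed.

(** The sublevel sets of [f] in [K] at its values are nested and nonempty, so they generate a proper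
    filter. A cluster point of it is a minimizer: if f y < f x, semicontinuity would separate x from
    the sublevel set of y. *)
Lemma lower_semicontinuous_min (K : set X) f : K !=set0 -> compact K ->
  (forall x, -oo < f x) -> lower_semicontinuous f ->
  exists2 x, K x & forall y, K y -> f x <= f y.
Proof.
move=> [x0 Kx0] cK nf lf.
pose F := filter_from K (fun y => [set x | K x /\ f x <= f y]).
have FF : ProperFilter F.
  apply: filter_from_proper; last by move=> y Ky; exists y.
  apply: filter_from_filter; first by exists x0.
  move=> y1 y2 K1 K2; have [y12|y21] := leP (f y1) (f y2).
    by exists y1 => // z [Kz zy]; split; split => //; exact: le_trans y12.
  by exists y2 => // z [Kz zy]; split; split => //; exact: le_trans (ltW y21).
have [|x [Kx clx]] := cK F FF; first by exists x0 => // x [].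
exists x => // y Ky; rewrite leNgt; apply/negP => yx.
have := nf y; case fyE: (f y) => [r| |]// _; last by move: yx; rewrite fyE ltNge leey.
have /lf[V xV Vr] : r%:E < f x by rewrite -fyE.
have [|z [[Kz zy] Vz]] := clx [set x | K x /\ f x <= f y] V _ xV; first by exists y.
by have := lt_le_trans (Vr z Vz) zy; rewrite fyE ltxx.
Qed.

End lower_semicontinuity.

Lemma row_coord_continuous (T : topologicalType) n (i : 'I_n) :
  continuous (fun v : 'rV[T]_n => v ord0 i).
Proof.
move=> v A vA; exists (fun _ j => if j == i then A else setT).
  by move=> k j; rewrite ord1; case: eqVneq => [->|_]; [exact: vA|exact: filterT].
by move=> w /= /(_ ord0 i); rewrite eqxx.
Qed.

(** Links the double sum of [config_energy] to [pairsum]. In the induction, the first point is met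
    once as [i] and once as [j], whence the factor 2. *)
Lemma sum_neq_ord_pairsum (V : zmodType) (W : nmodType) (k : V -> W) n (x : 'I_n -> V) :
  (forall z, k (- z) = k z) ->
  \sum_(i < n) \sum_(j < n | i != j) k (x i - x j) =
  pairsum k [seq x i | i <- enum 'I_n] *+ 2.
Proof.
move=> kN; elim: n x => [|n IHn] x; first by rewrite big_ord0 enum_ord0 mul0rn.
have e0 : \sum_(j < n.+1 | ord0 != j) k (x ord0 - x j) =
    \sum_(j < n) k (x ord0 - x (lift ord0 j)).
  by rewrite big_mkcond big_ord_recl /= add0r.
have eS i : \sum_(j < n.+1 | lift ord0 i != j) k (x (lift ord0 i) - x j) =
    k (x ord0 - x (lift ord0 i)) +
    \sum_(j < n | i != j) k (x (lift ord0 i) - x (lift ord0 j)).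
  rewrite big_mkcond big_ord_recl /= -kN opprB; congr (_ + _).
  by rewrite [RHS]big_mkcond; apply: eq_bigr => j _; rewrite (inj_eq lift_inj).
rewrite big_ord_recl e0 (eq_bigr _ (fun i _ => eS i)) big_split /=.
rewrite enum_ordSl /= -map_comp mulrnDl -(IHn (x \o lift ord0)) big_map big_enum /=.
by rewrite mulr2n addrA.
Qed.

(** * Empirical measures as probability measures *)

Section empirical_measure.
Context {R : realType} {N : nat}.

(** Built with [mscale] and [msum] to inherit the measure structure. [msum] is indexed by natural
    numbers, hence [inord], which needs a nonempty ordinal type. *)
Definition empirical_measure n (x : 'I_n.+1 -> 'rV[R]_N) : set 'rV[R]_N -> \bar R :=
  mscale (n.+1%:R^-1)%:nng (msum (fun k => \d_(x (inord k))) n.+1).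

HB.instance Definition _ n x := Measure.on (@empirical_measure n x).

Lemma empirical_measureE n (x : 'I_n.+1 -> 'rV[R]_N) A :
  empirical_measure x A = empirical x A.
Proof.
rewrite /empirical_measure /mscale /msum /empirical /=; congr (_ * _)%E.
by apply: eq_bigr => i _; rewrite inord_val.
Qed.

Lemma empirical_measure_setT n (x : 'I_n.+1 -> 'rV[R]_N) :
  empirical_measure x setT = 1%E.
Proof.
rewrite empirical_measureE /empirical (eq_bigr (fun=> 1%E)) => [|i _]; last exact: diracT.
by rewrite sumEFin sumr_const card_ord -EFinM mulVf// pnatr_eq0.
Qed.

HB.instance Definition _ n x := Measure_isProbability.Build _ _ _ (@empirical_measure n x)
  (empirical_measure_setT x).

End empirical_measure.

Section minimizing_configuration.
Context {R : realType} {N : nat}.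
Variables (g : 'rV[R]_N -> \bar R) (c : R).
Hypothesis gN : forall x, g (- x) = g x.
Hypothesis g_ge : forall x, ((- c)%:E <= g x)%E.
Hypothesis g_lsc : lower_semicontinuous g.
Local Notation f := (fine \o g).

(** Configurations are encoded as rows of points, to which [rv_compact]-style compactness of
    products of balls applies below. *)
Lemma lower_semicontinuous_pairsum n :
  lower_semicontinuous (fun v : 'rV['rV[R]_N]_n =>
    \sum_(i < n) \sum_(j < n | i != j) g (v ord0 i - v ord0 j))%E.
Proof.
have g_gt x : (-oo < g x)%E by exact: lt_le_trans (ltNyr _) (g_ge x).
apply: lower_semicontinuous_sum => [i v|i]; first exact: sume_gtNy.
apply: lower_semicontinuous_sum => [j v|j]; first exact: g_gt.
apply: (lower_semicontinuous_comp (h := fun v : 'rV['rV[R]_N]_n => v ord0 i - v ord0 j)) => // v.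
by apply: (@cvgB _ _ _ (nbhs v) (nbhs_filter v)); exact: row_coord_continuous.
Qed.

(** The energy is minimized over the configurations in the ball of radius [rho], a compact set. A
    competitor of finite energy is replaced by one in this ball: its improvement if its energy is at
    most [L], and the fixed [y0] otherwise. *)
Lemma exists_min_configuration n (rho L : R) :
  (exists s, [/\ size s = n, pairwise (fin_rel g) s & pairsum f s <= L]) ->
  (forall s, size s = n -> pairwise (fin_rel g) s -> pairsum f s <= L ->
    exists y, [/\ size y = n, forall x, x \in y -> `|x| <= rho,
      pairwise (fin_rel g) y & pairsum f y <= pairsum f s]) ->
  exists x : 'I_n -> 'rV[R]_N, forall x' : 'I_n -> 'rV[R]_N,
    (config_energy g x <= config_energy g x')%E.
Proof.
move=> [s0 [s0n adm0 P0]] H.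
have g_gt x : (-oo < g x)%E by exact: lt_le_trans (ltNyr _) (g_ge x).
pose Phi (x : 'I_n -> 'rV[R]_N) := pairsum g [seq x i | i <- enum 'I_n].
pose K := [set v : 'rV['rV[R]_N]_n | forall i, `|v ord0 i| <= rho].
pose vec y : 'rV['rV[R]_N]_n := \row_i nth 0 y i.
have vecK y : size y = n -> [seq vec y ord0 i | i <- enum 'I_n] = y.
  move=> yn; rewrite (eq_map (fun i => mxE _ _ _ i)).
  by rewrite (map_comp (nth 0 y) val) val_enum_ord -yn map_nth_iota0 ?take_size.
have Kvec y : size y = n -> (forall x, x \in y -> `|x| <= rho) -> K (vec y).
  by move=> yn yrho i; rewrite mxE; apply/yrho/mem_nth; rewrite yn.
have [y0 [y0n y0rho adm_y0 Py0]] := H s0 s0n adm0 P0.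
have [|||v Kv vmin] := @lower_semicontinuous_min R _ K
  (fun v => \sum_(i < n) \sum_(j < n | i != j) g (v ord0 i - v ord0 j))%E _ _ _
  (@lower_semicontinuous_pairsum n).
- by exists (vec y0); exact: Kvec.
- by apply: (@rV_compact _ n (fun=> [set x | `|x| <= rho])) => _; exact: compact_cball_rV.
- by move=> v; apply: sume_gtNy => i; exact: sume_gtNy.
exists (fun i => v ord0 i) => x'.
rewrite /config_energy; apply: lee_wpmul2l; first by rewrite lee_fin invr_ge0 exprn_ge0.
set s := [seq x' i | i <- enum 'I_n].
have sn : size s = n by rewrite size_map size_enum_ord.
rewrite [leRHS](sum_neq_ord_pairsum x' gN) -/s.
have [soo|] := ltP (pairsum g s) +oo%E; last first.
  by rewrite leye_eq => /eqP ->; rewrite mulr2n leey.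
have adms := pairsum_lty g_gt soo.
have [y [yn yrho admy Py]] : exists y, [/\ size y = n, forall x, x \in y -> `|x| <= rho,
    pairwise (fin_rel g) y & pairsum f y <= pairsum f s].
  have [/(H s sn adms)//|Ls] := leP (pairsum f s) L.
  by exists y0; split=> //; apply: le_trans Py0 (le_trans P0 (ltW Ls)).
apply: le_trans (vmin _ (Kvec y yn yrho)) _.
rewrite (sum_neq_ord_pairsum (fun i => vec y ord0 i) gN) vecK// !pairsum_fine// !mulr2n.
by rewrite -!EFinD lee_fin lerD.
Qed.

End minimizing_configuration.

Lemma empirical_measure_minimizer (R : realType) (N n : nat) (g : 'rV[R]_N -> \bar R)
    (x : 'I_n.+1 -> 'rV[R]_N) :
  (forall y : 'I_n.+1 -> 'rV[R]_N, (config_energy g x <= config_energy g y)%E) ->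
  is_minimizer g n.+1 (empirical_measure x : probability 'rV[R]_N R).
Proof.
move=> xmin.
have xrep : represents x (empirical_measure x : probability 'rV[R]_N R).
  by move=> A _; exact: empirical_measureE.
split; first by exists x.
apply/eqP; rewrite eq_le; apply/andP; split; last first.
  by apply: ereal_inf_lbound; exists (empirical_measure x : probability 'rV[R]_N R).
rewrite (discrete_energyE g xrep); apply: le_ereal_inf_tmp => _ [nu _ <-].
rewrite /discrete_energy; case: pselect => [h|_]; last exact: leey.
exact: xmin.
Qed.

Theorem theorem10 (R : realType) (N : nat) (N1 : (1 <= N)%N)
  (g : 'rV[R]_N -> \bar R)
  (g_fin : forall x : 'rV[R]_N, x != 0 -> g x \is a fin_num)
  (g_0 : (-oo < g 0%R)%E)
  (g_sym : forall x : 'rV[R]_N, g x = g (- x))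
  (g_lb : exists c : R, forall x, (c%:E <= g x)%E)
  (g_lsc : lower_semicontinuous g)
  (g_L1loc : locally_integrable_rV g)
  (g_liminf : (0 <= limf_einf g at_infinity)%E)
  (g_cont : {within [set~ (0 : 'rV[R]_N)], continuous g})
  (g_decr : exists2 r : R, 0 < r & forall x y : 'rV[R]_N,
    0 < enorm x -> enorm x <= enorm y -> enorm y < r -> (g y <= g x)%E)
  (g_neg : exists mu0 : probability 'rV[R]_N R, (energy g mu0 < 0)%E) :
  exists nbar : nat, forall n : nat, (nbar < n)%N ->
    exists mu : probability 'rV[R]_N R, is_minimizer g n mu.
Proof.
case: N N1 g g_fin g_0 g_sym g_lb g_lsc g_L1loc g_liminf g_cont g_decr g_neg => // N _ g.
move=> g_fin _ g_sym [c0 g_c0] g_lsc g_L1loc g_liminf g_cont g_decr [mu0 mu0_neg].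
have gN x : g (- x) = g x by [].
(* A strictly positive [c] is required, since the proportion of points in a crowded ball is B /
   c. *)
pose c := `|c0| + 1.
have c_gt0 : 0 < c by rewrite ltr_wpDl.
have g_ge x : ((- c)%:E <= g x)%E.
  apply: le_trans (g_c0 x); rewrite lee_fin /c.
  by have := ler_norm (- c0); rewrite normrN; lra.
have [rho [n0 conf]] :=
  confinement c_gt0 g_fin gN g_ge g_lsc g_L1loc g_liminf g_cont g_decr mu0_neg.
exists n0 => -[//|n] n0n; have [L [ex_s improve]] := conf _ (ltnW n0n).
have [x xmin] := exists_min_configuration gN g_ge g_lsc ex_s improve.
by exists (empirical_measure x); exact: empirical_measure_minimizer.
Qed.
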